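(* For every $f\in\mathcal F$ there is a Borel probability measure $\mu$ supported by $[0,1]$ whose multifractal spectrum satisfies: (i) for all $h\in\mathrm{Support}(f)\setminus\{1\}$, $d_\mu(h)=f(h)$; (ii) $d_\mu(h)=-\infty$ for every real $h\ge 0$ with $h\notin \mathrm{Support}(f)\cup\{1\}$; (iii) the set $\{x\in[0,1]:h_\mu(x)=1\}$ has Lebesgue measure $1$. In particular, $\mathrm{Support}(d_\mu)=\mathrm{Support}(f)\cup\{1\}$.
   Context: For a positive Borel measure $\mu$, $\mathrm{Supp}(\mu)$ is the smallest closed set whose complement has $\mu$-measure $0$. For $x_0\in \mathrm{Supp}(\mu)$ the (lower) local dimension is $h_\mu(x_0)=\liminf_{r\to0^+}\frac{\log\mu(B(x_0,r))}{\log r}$, where $B(x_0,r)$ is the open ball; for $x_0\notin \mathrm{Supp}(\mu)$ one sets $h_\mu(x_0)=+\infty$. Let $\dim$ denote Hausdorff dimension with the convention $\dim\emptyset=-\infty$. The multifractal spectrum of $\mu$ (supported in $[0,1]$) is $d_\mu(h)=\dim\{x\in[0,1]:h_\mu(x)=h\}$ for real $h\ge0$, and $\mathrm{Support}(d_\mu)=\{h\ge0: d_\mu(h)\ge0\}$. For a function $f$ with values in $[0,1]\cup\{-\infty\}$, $\mathrm{Support}(f)=\{x:f(x)>-\infty\}$. The set $\mathcal F$ consists of the functions $f:[0,1]\to[0,1]\cup\{-\infty\}$ for which there is a countable family $(f_n)_{n\ge1}$ of functions $f_n:[0,+\infty]\to[0,1]\cup\{-\infty\}$ such that: for every $n$,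 $\mathrm{Support}(f_n)$ is a closed, possibly degenerate (one-point), interval $I_n\subset[0,1]$; $\inf_{n\ge1}\min(I_n)>0$; $f_n$ is constant on $I_n$; $f_n(x)\le x$ for every $x\in I_n$; and $f(x)=\sup_{n\ge1}f_n(x)$ for every $x\in[0,1]$ (so $f=-\infty$ off $\bigcup_n I_n$). *)

(* Defs.v *)
From HB Require Import structures.
From mathcomp Require Import all_boot all_order all_algebra.
From mathcomp Require Import all_classical all_reals all_analysis.
Set Implicit Arguments.
Unset Strict Implicit.
Unset Printing Implicit Defensive.
Import Order.TTheory GRing.Theory Num.Theory.
Import numFieldNormedType.Exports.
Local Open Scope classical_set_scope.
Local Open Scope ring_scope.
Local Open Scope ereal_scope.

Section hausdorff_dimension.
Context {R : realType}.
Implicit Types (s delta : R) (U E : set R).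

(* The value is -oo on the empty set, which [gauge] treats apart. *)
Definition diam U : \bar R :=
  ereal_sup [set `|x - y|%:E | x in U & y in U].

(* The empty set has gauge 0 also for s = 0, whereas a one-point set then has
   gauge 1; hence a sequence of sets also encodes a finite cover. *)
Definition gauge s U : \bar R :=
  if U == set0 then 0 else poweR (diam U) s.

Definition hausdorff_pre s delta E : \bar R :=
  ereal_inf [set \sum_(n <oo) gauge s (U n) | U in
    [set U : (set R)^nat | E `<=` \bigcup_n U n /\
                           forall n, diam (U n) <= delta%:E]].

Definition hausdorff_measure s E : \bar R :=
  ereal_sup [set hausdorff_pre s delta E | delta in [set delta | (0 < delta)%R]].

Definition hausdorff_dim E : \bar R :=
  if E == set0 then -oo else
  ereal_inf [set s%:E | s in
    [set s | (0 <= s)%R /\ hausdorff_measure s E = 0]].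

End hausdorff_dimension.

Section multifractal.
Context {R : realType}.
Variable mu : {measure set (measurableTypeR R) -> \bar R}.

(* The intersection is the smallest such F because R is second countable. *)
Definition measure_supp : set R :=
  \bigcap_(F in [set F : set R | closed F /\ mu (~` F) = 0]) F.

Definition local_dim (x : R) : \bar R :=
  if x \in measure_supp then
    limf_einf (fun r : R => lne (mu (ball x r)) / (ln r)%:E) 0^'+
  else +oo.

Definition level_set (h : R) : set R :=
  [set x | x \in `[0, 1]%R /\ local_dim x = h%:E].

Definition spectrum (h : R) : \bar R := hausdorff_dim (level_set h).

Definition spectrum_supp : set R := [set h | (0 <= h)%R /\ 0 <= spectrum h].

End multifractal.

(* The sigma-algebra on which [completed_lebesgue_measure] is a measure;
   [lebesgue_measure] is declared as a measure on the Borel sets only. *)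
Definition lebesgue_measurable {R : realType} (A : set R) : Prop :=
  (wlength idfun)^*%mu.-cara.-measurable A.

(* A function D -> [0, 1] U {-oo} is represented by a total function whose
   values outside of D are irrelevant. *)
Definition valued01 {R : realType} {T : Type} (D : set T) (f : T -> \bar R) :=
  forall x, D x -> f x = -oo \/ 0 <= f x <= 1.

Definition fsupp {R : realType} {T : Type} (D : set T) (f : T -> \bar R) :
    set T :=
  [set x | D x /\ f x > -oo].

(* The support of fn n is I_n = [a n, b n], so min I_n = a n. *)
Record F_family {R : realType} (f : R -> \bar R)
    (fn : nat -> \bar R -> \bar R) (a b : nat -> R) : Prop := {
  F_valued : forall n, valued01 `[0, +oo] (fn n) ;
  F_itv : forall n, (0 <= a n)%R /\ (a n <= b n)%R /\ (b n <= 1)%R ;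
  F_supp : forall n, fsupp `[0, +oo] (fn n) = EFin @` `[a n, b n]%classic ;
  F_inf_gt0 : (0 < inf (range a))%R ;
  F_cst : forall n, {in `[a n, b n]%R &, forall x y, fn n x%:E = fn n y%:E} ;
  F_le : forall n, {in `[a n, b n]%R, forall x, fn n x%:E <= x%:E} ;
  F_sup : {in `[0, 1]%R, forall x,
    f x = ereal_sup (range (fun n => fn n x%:E))} }.

Definition class_F {R : realType} (f : R -> \bar R) : Prop :=
  valued01 `[0%R, 1%R] f /\ exists fn a b, F_family f fn a b.

(* Main.v *)
Require Import Defs.
From HB Require Import structures.
From mathcomp Require Import all_boot all_order all_algebra.
From mathcomp Require Import ring lra.
From mathcomp Require Import all_classical all_reals all_analysis.
Import Order.TTheory GRing.Theory Num.Theory.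
Import numFieldNormedType.Exports.
Local Open Scope classical_set_scope.
Local Open Scope ring_scope.
Set Implicit Arguments.
Unset Strict Implicit.
Unset Printing Implicit Defensive.

(** The measure is a multiple of Lebesgue measure on [0, 1] plus countably many
    measures with locally bounded density outside small Cantor sets, one for
    each interval I_n = [a, b] on which f is at least the constant c <= a. The
    n-th one lives in a closed interval of its own; these intervals are
    disjoint and accumulate at 0 only, with masses so small that the local
    dimension at 0 remains 1.

    In one such interval (a cell), let the generations k of a Cantor set consist
    of intervals of length l_k, placed at the points of a grid of step d_k that
    lie inside the intervals of the previous generation. The lengths l_k
    decrease so fast that every quantity depending on l_(k-1) and k is
    l_k ^ o(1), and d_k is l_k ^ c up to such a factor. There are at most about
    1 / d_k intervals, so the Cantor set has dimension at most c
    ([hausdorff_cantor_eq0]) and is Lebesgue null. The interval of number i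
    carries the extra mass w_k * l_k ^ h, spread uniformly, where the exponent
    h = expo k i in [a, b] depends on i modulo k + 2 only, and where
    w_k = l_k ^ o(1) makes all the masses summable.

    A ball of radius r centred on the Cantor set and smaller than the grid step
    meets a single interval of generation k, and gets from it a mass of at most
    r ^ h ([gen_measure_ball_small]). A larger ball does not distinguish
    generation k from Lebesgue measure: since c <= h, an interval is not heavier
    than the grid step is long ([gen_measure_ball_large]). As a ball of radius
    2 * l_k contains its interval of generation k, the local dimension on the
    Cantor set stays in [a, b], and it is the limit of the exponents when they
    converge ([local_dim_in_cvg]). A branch_point outside of the Cantor set sees
    finitely many generations, that is, a bounded density: its local dimension
    is 1 ([local_dim_out]), which settles the level 1 almost everywhere.

    For h in [a, b], choose in every generation the residue modulo k + 2 whose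
    exponent is closest to h. The points all of whose intervals have the chosen
    residues are in the level set of h, and these intervals still branch about
    l_k ^ (- c) times. Numbering the branches by the mixed radix expansion of a
    real number in [0, 1) yields a map with inverse of Hoelder exponent c
    ([cantor_holder]), so that the level set has dimension at least c
    ([hausdorff_dim_ge]). Altogether a level set of h <> 1 is contained in the
    union of the Cantor sets of the n with h in I_n, and its dimension is the
    supremum of the corresponding constants, namely f h. *)

(** * Hausdorff measure and dimension *)

Section hausdorff_facts.
Context {R : realType}.
Implicit Types (s delta : R) (U E : set R).
Local Open Scope ereal_scope.

Lemma gauge_ge0 s U : 0 <= gauge s U.
Proof. by rewrite /gauge; case: ifP => // _; exact: poweR_ge0. Qed.

Lemma gauge_set0 s : gauge s (set0 : set R) = 0.
Proof. by rewrite /gauge eqxx. Qed.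

Lemma diam_itv (a b : R) : (a <= b)%R -> diam `[a, b] <= (b - a)%:E.
Proof.
move=> ab; apply: ge_ereal_sup => _ [x + [y + <-]].
by rewrite /= !in_itv/= lee_fin ler_norml => ? ?; apply/andP; split; lra.
Qed.

Lemma dist_le_diam U x y : U x -> U y -> `|x - y|%:E <= diam U.
Proof. by move=> Ux Uy; apply: ereal_sup_ubound; exists x => //; exists y. Qed.

Lemma gauge_itv_le s (a b : R) : (0 <= s)%R -> (a <= b)%R ->
  gauge s `[a, b] <= ((b - a) `^ s)%:E.
Proof.
move=> s0 ab; rewrite /gauge; case: ifPn => [_|_]; first by rewrite lee_fin powR_ge0.
rewrite -poweR_EFin; apply: gt0_ler_poweR; rewrite ?diam_itv// in_itv/= leey andbT.
  apply: (@le_trans _ _ `|a - a|%:E); first by rewrite lee_fin.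
  by apply: dist_le_diam; rewrite /= in_itv/= lexx.
by rewrite lee_fin subr_ge0.
Qed.

Lemma hausdorff_pre_ge0 s delta E : 0 <= hausdorff_pre s delta E.
Proof.
apply: le_ereal_inf_tmp => _ [U _ <-].
by apply: nneseries_ge0 => n _ _; exact: gauge_ge0.
Qed.

Lemma hausdorff_measure_eq0P s E : hausdorff_measure s E = 0 <->
  forall delta e : R, (0 < delta)%R -> (0 < e)%R ->
  exists U : (set R)^nat, [/\ E `<=` \bigcup_n U n,
    forall n, diam (U n) <= delta%:E & \sum_(n <oo) gauge s (U n) <= e%:E].
Proof.
split=> [H0 delta e d0 e0|H].
  have : hausdorff_pre s delta E <= 0.
    by rewrite -H0; apply: ereal_sup_ubound; exists delta.
  move=> pre0; have {}pre0 : hausdorff_pre s delta E = 0.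
    by apply/eqP; rewrite eq_le pre0 hausdorff_pre_ge0.
  have fpre : hausdorff_pre s delta E \is a fin_num by rewrite pre0.
  have [_ [U [EU dU] <-]] := lb_ereal_inf_adherent e0 fpre.
  by rewrite -/(hausdorff_pre _ _ _) pre0 add0e => /ltW ?; exists U.
apply/eqP; rewrite eq_le; apply/andP; split.
  apply: ge_ereal_sup => _ [delta d0 <-].
  apply/lee_addgt0Pr => e e0; rewrite add0e.
  have [U [EU dU Ue]] := H delta e d0 e0.
  by apply: le_trans Ue; apply: ereal_inf_lbound; exists U.
apply: (le_trans (hausdorff_pre_ge0 s 1 E)).
by apply: ereal_sup_ubound; exists 1%R => //=.
Qed.

Lemma sub_hausdorff_measure_eq0 s E F :
  E `<=` F -> hausdorff_measure s F = 0 -> hausdorff_measure s E = 0.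
Proof.
move=> EF /hausdorff_measure_eq0P H; apply/hausdorff_measure_eq0P => d e d0 e0.
by have [U [FU dU Ue]] := H d e d0 e0; exists U; split=> //; exact: subset_trans FU.
Qed.

(** Countable stability, by the usual splitting of e into e / 2 ^ (n + 1); the
    covers of all the E n are merged through a bijection of nat with nat * nat.
*)
Lemma hausdorff_measure_bigcup_eq0 s (E : (set R)^nat) :
  (forall n, hausdorff_measure s (E n) = 0) ->
  hausdorff_measure s (\bigcup_n E n) = 0.
Proof.
move=> E0; apply/hausdorff_measure_eq0P => d e d0 e0.
have [G PG] : {G : ((set R)^nat)^nat & forall n, [/\ E n `<=` \bigcup_k G n k,
    forall k, diam (G n k) <= d%:E
    & \sum_(k <oo) gauge s (G n k) <= (e / (2 ^ n.+1)%:R)%:E]}.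
  apply: (@choice _ _ (fun n (B : (set R)^nat) => [/\ E n `<=` \bigcup_k B k,
    forall k, diam (B k) <= d%:E &
    \sum_(k <oo) gauge s (B k) <= (e / (2 ^ n.+1)%:R)%:E])) => n.
  have en : (0 < e / (2 ^ n.+1)%:R)%R.
    by rewrite divr_gt0// ltr0n expn_gt0.
  have /hausdorff_measure_eq0P/(_ d _ d0 en)[U [? ? ?]] := E0 n.
  by exists U.
have /card_esym/ppcard_eqP[f] := card_nat2.
exists (uncurry G \o f); split.
- move=> t [i _ Eit]; have [P _ _] := PG i; have [j _ Gij] := P _ Eit.
  by exists (f^-1%FUN (i, j)) => //=; rewrite invK ?inE.
- by move=> n /=; case: (f n) => i j; have [_ + _] := PG i; exact.
- have g0 x : 0 <= (gauge s \o uncurry G) x by exact: gauge_ge0.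
  have -> : \sum_(n <oo) gauge s ((uncurry G \o f) n) =
      \esum_(i in setT) (gauge s \o uncurry G) i.
    rewrite -(esum_pred_image (gauge s \o uncurry G) f xpredT) ?[fun=> _]set_true//.
    by rewrite image_eq.
  rewrite (_ : esum _ _ = \sum_(i <oo) \sum_(j <oo) gauge s (G i j)); last first.
    rewrite nneseries_esumT; last first.
      by move=> i; apply: nneseries_ge0 => ? _ _; exact: gauge_ge0.
    transitivity (\esum_(i in [set: nat]) \esum_(j in [set: nat])
      gauge s (G i j)); last first.
      apply: eq_esum => i _; rewrite nneseries_esumT// => j; exact: gauge_ge0.
    rewrite esum_esum; last by move=> ? ? _ _; exact: gauge_ge0.
    rewrite (_ : _ `*`` _ = setT); last by apply/seteqP; split.
    by apply: eq_esum => -[i j].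
  apply: (@le_trans _ _ (\sum_(i <oo) (e / (2 ^ i.+1)%:R)%:E)).
    apply: lee_nneseries => i _; last by case: (PG i).
    by move=> _; apply: nneseries_ge0 => ? _ _; exact: gauge_ge0.
  exact: epsilon_trick0 (ltW e0).
Qed.

Lemma hausdorff_dim_le E (c : R) : E !=set0 -> (0 <= c)%R ->
  (forall s : R, (c < s)%R -> hausdorff_measure s E = 0) ->
  hausdorff_dim E <= c%:E.
Proof.
move=> /set0P E0 c0 H; rewrite /hausdorff_dim (negbTE E0).
apply/lee_addgt0Pr => e e0; apply: ereal_inf_lbound.
exists (c + e)%R => //=; split; first by rewrite addr_ge0// ltW.
by apply: H; rewrite ltrDl.
Qed.

Lemma hausdorff_dim_ge0 E : E !=set0 -> 0 <= hausdorff_dim E.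
Proof.
move=> /set0P E0; rewrite /hausdorff_dim (negbTE E0).
by apply: le_ereal_inf_tmp => _ [s [s0 _] <-]; rewrite lee_fin.
Qed.

(** Mass distribution principle without a measure on E: a cover of E pulls back
    along x to a cover of [0, 1) by sets of diameter at most C * diam U ^ c,
    hence the sums of the diam U ^ c are bounded below by Lebesgue measure. *)
Lemma hausdorff_dim_ge E (c C : R) (x : R -> R) : (0 <= c)%R -> (0 < C)%R ->
  (forall y : R, (0 <= y < 1)%R -> E (x y)) ->
  (forall y z : R, (0 <= y < 1)%R -> (0 <= z < 1)%R ->
    (`|y - z| <= C * `|x y - x z| `^ c)%R) ->
  c%:E <= hausdorff_dim E.
Proof.
move=> c0 C0 Ex Hx.
have E0 : E !=set0 by exists (x 0%R); apply: Ex; rewrite lexx ltr01.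
rewrite /hausdorff_dim; case: ifPn => [/eqP E_0|_]; first by case: E0; rewrite E_0.
apply: le_ereal_inf_tmp => _ [s [s0 /hausdorff_measure_eq0P Hs] <-].
rewrite lee_fin leNgt; apply/negP => sc.
pose e := (4 * C)^-1%R.
have e0 : (0 < e)%R by rewrite invr_gt0 mulr_gt0.
have [U [EU dU Ue]] := Hs 1%R e ltr01 e0.
have [I HI] : {I : (set (measurableTypeR R))^nat & forall n, [/\ measurable (I n),
    forall y : R, (0 <= y < 1)%R -> U n (x y) -> I n y
    & lebesgue_measure (I n) <= (2 * C)%:E * gauge s (U n)]}.
  apply: (@choice _ _ (fun n (I : set (measurableTypeR R)) => [/\ measurable I,
    forall y : R, (0 <= y < 1)%R -> U n (x y) -> I y
    & lebesgue_measure I <= (2 * C)%:E * gauge s (U n)])) => n.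
  have [[y0 [y01 Uy0]]|] :=
    pselect (exists y : R, (0 <= y < 1)%R /\ U n (x y)); last first.
    move=> nU; exists set0; split=> // [y y01 Uy|]; first by case: nU; exists y.
    by rewrite measure0 mule_ge0 ?gauge_ge0// lee_fin mulr_ge0// ltW.
  have Un0 : U n != set0 by apply/set0P; exists (x y0).
  have := dU n; have : 0 <= diam (U n).
    by apply: (le_trans _ (dist_le_diam Uy0 Uy0)); rewrite lee_fin.
  case E1 : (diam (U n)) => [D| |]//; rewrite !lee_fin => D0 D1.
  rewrite /gauge (negbTE Un0) E1 poweR_EFin.
  (* diameters are at most 1, so a smaller exponent gives a larger gauge *)
  have DcDs : (D `^ c <= D `^ s)%R.
    have [->|Dn0] := eqVneq D 0%R.
      rewrite powR0 ?powR_ge0//; apply/eqP => cE.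
      by move: s0; rewrite leNgt -cE sc.
    by apply: ger_powR; rewrite ?lt0r ?Dn0 ?D0 ?D1 ?(ltW sc).
  exists `[(y0 - C * D `^ c)%R, (y0 + C * D `^ c)%R]%classic; split.
  - exact: measurable_itv.
  - move=> y y01' Uy; rewrite /= in_itv/=.
    have H1 := Hx _ _ y01' y01.
    have H2 : (C * `|x y - x y0| `^ c <= C * D `^ c)%R.
      rewrite ler_pM2l// ge0_ler_powR ?nnegrE//.
      by rewrite -lee_fin -E1; exact: dist_le_diam.
    by have := le_trans H1 H2; rewrite ler_norml => /andP[? ?]; apply/andP; split; lra.
  - rewrite lebesgue_measure_itv/=; case: ifPn => _; last first.
      by rewrite -EFinM lee_fin !mulr_ge0 ?powR_ge0// ltW.
    rewrite -EFinB -EFinM lee_fin.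
    have : (C * D `^ c <= C * D `^ s)%R by rewrite ler_pM2l.
    lra.
have : lebesgue_measure (`[0%R, 1%R[%classic : set (measurableTypeR R)) <=
    \sum_(n <oo) lebesgue_measure (I n).
  apply: measure_sigma_subadditive => //.
    by move=> n; case: (HI n).
  move=> y /=; rewrite in_itv/= => y01; have [n _ Uny] := EU _ (Ex _ y01).
  by exists n => //; have [_ + _] := HI n; exact.
apply/negP; rewrite -ltNge lebesgue_measure_itv/= lte_fin ltr01 oppr0 adde0.
apply: (@le_lt_trans _ _ (\sum_(n <oo) (2 * C)%:E * gauge s (U n))).
  by apply: lee_nneseries => n _ //; case: (HI n).
rewrite nneseriesZl; last by move=> ? _; exact: gauge_ge0.
apply: (@le_lt_trans _ _ ((2 * C)%:E * e%:E)).
  by rewrite lee_pmul2l// lte_fin mulr_gt0.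
rewrite -EFinM lte_fin /e.
have -> : (2 * C * (4 * C)^-1 = 2^-1 :> R)%R by field; rewrite lt0r_neq0.
lra.
Qed.

End hausdorff_facts.

(** * Local dimension *)

Section local_dimension_facts.
Context {R : realType} (mu : {measure set (measurableTypeR R) -> \bar R}).
Implicit Types (x r eta C : R).

(** Multiplicative constants do not affect a ratio of logarithms in the limit:
    ln C / ln r tends to 0. *)
Lemma log_ratio_le C eta e : 0 < C -> 0 < e ->
  \forall r \near (0 : R)^'+, forall v, 0 < v ->
    (C * r `^ eta <= v -> ln v / ln r <= eta + e) /\
    (v <= C * r `^ eta -> eta - e <= ln v / ln r).
Proof.
move=> C0 e0.
pose q := expR (- (`|ln C| / e) - 1).
near=> r => v v0.
have r0 : 0 < r by near: r; exact: nbhs_right_gt.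
have rq : r < q by near: r; apply: nbhs_right_lt; exact: expR_gt0.
have lr : ln r < - (`|ln C| / e) - 1.
  by rewrite -(expRK (- _ - 1)) ltr_ln ?posrE ?expR_gt0.
have Ce0 : 0 <= `|ln C| / e by rewrite divr_ge0 ?normr_ge0 ?ltW.
have lr0 : ln r < 0 by lra.
have lre : `|ln C| <= - ln r * e.
  rewrite -ler_pdivrMr//; lra.
have [l1 l2] : ln C <= - ln r * e /\ - (- ln r * e) <= ln C.
  by move: lre; rewrite ler_norml => /andP[].
have lnE : ln (C * r `^ eta) = ln C + eta * ln r.
  by rewrite lnM ?posrE ?powR_gt0// ln_powR.
have C1 : 0 < C * r `^ eta by rewrite mulr_gt0 ?powR_gt0.
split=> h.
  have : ln (C * r `^ eta) <= ln v by rewrite ler_ln.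
  by rewrite lnE ler_ndivrMr// => h1; nra.
have : ln v <= ln (C * r `^ eta) by rewrite ler_ln.
by rewrite lnE ler_ndivlMr// => h1; nra.
Unshelve. all: by end_near. Qed.

Lemma lne_div_ln r (v : R) : 0 < v -> r != 1 -> 0 < r ->
  (lne v%:E / (ln r)%:E)%E = (ln v / ln r)%:E.
Proof.
move=> v0 r1 r0; rewrite /lne leNgt v0/= inver.
by rewrite ln_eq0// (negbTE r1) EFinM.
Qed.

Lemma local_dim_ge x eta C : x \in measure_supp mu -> 0 < C ->
  (\forall r \near 0^'+, (0 < mu (ball x r) <= (C * r `^ eta)%:E)%E) ->
  (eta%:E <= local_dim mu x)%E.
Proof.
move=> xs C0 H; rewrite /local_dim xs; apply/lee_subgt0Pr => e e0.
rewrite limf_einfE; apply: ereal_sup_ge => /=.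
have [V V0 HV] : exists2 V : set R, nbhs 0^'+ V & forall r, V r ->
    ((eta - e)%:E <= lne (mu (ball x r)) / (ln r)%:E)%E.
  exists [set r | ((eta - e)%:E <= lne (mu (ball x r)) / (ln r)%:E)%E] => //.
  near=> r => /=.
  have r0 : 0 < r by near: r; exact: nbhs_right_gt.
  have r1 : r < 1 by near: r; exact: nbhs_right_lt.
  have /andP[] : (0 < mu (ball x r) <= (C * r `^ eta)%:E)%E by near: r.
  have L : forall v, 0 < v ->
    (C * r `^ eta <= v -> ln v / ln r <= eta + e) /\
    (v <= C * r `^ eta -> eta - e <= ln v / ln r).
    by near: r; exact: log_ratio_le.
  case: (mu (ball x r)) => [v| |]//; rewrite lte_fin lee_fin => v0 vC.
  by rewrite lne_div_ln ?lt_eqF// lee_fin; have [_] := L v v0; exact.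
exists (ereal_inf [set lne (mu (ball x r)) / (ln r)%:E | r in V])%E.
  by exists V.
by apply: le_ereal_inf_tmp => _ [r Vr <-]; rewrite -EFinB; exact: HV.
Unshelve. all: by end_near. Qed.

(** Since the local dimension is a lower limit, arbitrarily small radii with a
    large mass are enough. *)
Lemma local_dim_le x eta C : x \in measure_supp mu -> 0 < C ->
  (forall r, mu (ball x r) < +oo)%E ->
  (forall d, 0 < d -> exists2 r, 0 < r < d &
    ((C * r `^ eta)%:E <= mu (ball x r))%E) ->
  (local_dim mu x <= eta%:E)%E.
Proof.
move=> xs C0 muoo H; rewrite /local_dim xs; apply/lee_addgt0Pr => e e0.
rewrite limf_einfE; apply: ge_ereal_sup => _ [V V0 <-].
have : \forall r \near (0 : R)^'+, [/\ V r, r < 1 & forall v, 0 < v ->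
    (C * r `^ eta <= v -> ln v / ln r <= eta + e) /\
    (v <= C * r `^ eta -> eta - e <= ln v / ln r)].
  near=> r; split; near: r => //; last exact: log_ratio_le.
  exact: nbhs_right_lt.
move=> [d /= d0 Hd]; have [r /andP[r0 rd] Hr] := H d d0.
have [|//|Vr r1 L] := Hd r.
  by rewrite /ball_/= sub0r normrN gtr0_norm.
apply: (@le_trans _ _ (lne (mu (ball x r)) / (ln r)%:E)%E).
  by apply: ereal_inf_lbound; exists r.
have C1 : 0 < C * r `^ eta by rewrite mulr_gt0 ?powR_gt0.
move: Hr (muoo r); case: (mu (ball x r)) => [v| |]//; rewrite lee_fin => Hr _.
have v0 : 0 < v by apply: lt_le_trans Hr.
by rewrite lne_div_ln ?lt_eqF// lee_fin; have [+ _] := L v v0; exact.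
Unshelve. all: by end_near. Qed.

End local_dimension_facts.

(** * The scales of a cell *)

(** The data of one building block: a Cantor set of dimension cdim inside
    [cleft, cright], on which the local dimensions range over [hmin, hmax]. *)
Record cell (R : realType) := Cell {
  hmin : R ; hmax : R ; cdim : R ; cleft : R ; cright : R ;
  cdim_ge0 : 0 <= cdim ;
  cdim_lt1 : cdim < 1 ;
  cdim_le_hmin : cdim <= hmin ;
  hmin_le_hmax : hmin <= hmax ;
  hmax_le1 : hmax <= 1 ;
  cleft_ge0 : 0 <= cleft ;
  cleft_lt_cright : cleft < cright ;
  cright_le1 : cright <= 1 }.

Section scales.
Context {R : realType} (B : cell R).
Local Notation a := (hmin B).
Local Notation b := (hmax B).
Local Notation c := (cdim B).
Local Notation u := (cleft B).
Local Notation v := (cright B).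

(** The exponent k + growth in [len] is at least 1 / (1 - c) for every k, which
    makes the intervals shorter than the grid step, and tends to infinity, which
    makes every positive power of [len k.+1] at most [slack k] for k large. *)
Definition growth : nat := (Num.truncn (1 - c)^-1).+1.

Fixpoint len (k : nat) : R :=
  if k is j.+1 then (len j / (2 ^+ j * (8 * j.+2%:R))) ^+ (j + growth)
  else v - u.

(** A quantity fixed before [len k.+1] is chosen, to which all the losses in
    generation k are compared. *)
Definition slack k : R := len k / (2 ^+ k * (8 * k.+2%:R)).

(** The grid step of generation k. The factor 4 * (k + 2) leaves room for
    len k.+1 ^ (- c) children in each residue class modulo k + 2. *)
Definition gap k : R := len k * len k.+1 `^ c / (4 * k.+2%:R).

(** Chosen so that weight k * len k.+1 ^ c = gap k / 2 ^ k ([weight_powRc]). *)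
Definition weight k : R := 2 * slack k.

Lemma len0 : len 0 = v - u.
Proof. by []. Qed.

Lemma lenS k : len k.+1 = slack k ^+ (k + growth).
Proof. by []. Qed.

Let pow2_ge1 k : (1 : R) <= 2 ^+ k.
Proof. by apply: exprn_ege1; rewrite ler1n. Qed.

Let pow2_gt0 k : (0 : R) < 2 ^+ k.
Proof. exact: lt_le_trans ltr01 (pow2_ge1 k). Qed.

Let kge1 k : (1 : R) <= k.+1%:R.
Proof. by rewrite ler1n. Qed.

Let den_ge8 k : (8 : R) <= 2 ^+ k * (8 * k.+2%:R).
Proof. have := pow2_ge1 k; have := kge1 k.+1; nra. Qed.

Let den_gt0 k : (0 : R) < 2 ^+ k * (8 * k.+2%:R).
Proof. by apply: lt_le_trans (den_ge8 k). Qed.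

Lemma len_gt0 k : 0 < len k.
Proof.
elim: k => [|k IH] /=; first by rewrite subr_gt0 cleft_lt_cright.
by rewrite exprn_gt0// divr_gt0.
Qed.

Lemma slack_gt0 k : 0 < slack k.
Proof. by rewrite divr_gt0// len_gt0. Qed.

Lemma slack_le_len k : 8 * slack k <= len k.
Proof.
rewrite /slack mulrA ler_pdivrMr// mulrC ler_pM2l ?len_gt0//.
Qed.

Lemma len_le1_lenS k : len k <= 1 /\ len k.+1 <= slack k.
Proof.
have lenS_le j : len j <= 1 -> len j.+1 <= slack j.
  move=> l1; rewrite lenS -[leRHS]expr1.
  apply: ler_wiXn2l; rewrite ?ltW ?slack_gt0//; last by rewrite /growth addnS.
  have := slack_le_len j; have := slack_gt0 j; lra.
suff l1 : len k <= 1 by split=> //; exact: lenS_le.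
elim: k => [|k IH]; first by have := cright_le1 B; have := cleft_ge0 B => /=; lra.
have := lenS_le _ IH; have := slack_le_len k; have := slack_gt0 k; lra.
Qed.

Lemma len_le1 k : len k <= 1. Proof. by have [] := len_le1_lenS k. Qed.

Lemma lenS_le_slack k : len k.+1 <= slack k.
Proof. by have [] := len_le1_lenS k. Qed.

Lemma slack_le1 k : slack k <= 1.
Proof. have := slack_le_len k; have := len_le1 k; have := slack_gt0 k; lra. Qed.

Lemma slack_le_pow k : slack k <= (2 ^+ k)^-1.
Proof.
rewrite /slack ler_pdivrMr// mulKf ?gt_eqF//.
by have := len_le1 k; have := kge1 k.+1; lra.
Qed.

Lemma lenS_le_len k : len k.+1 <= len k.
Proof.
have := lenS_le_slack k; have := slack_le_len k; have := slack_gt0 k; lra.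
Qed.

Lemma len_le_len0 k : len k <= v - u.
Proof. by elim: k => // k; apply: le_trans; exact: lenS_le_len. Qed.

Lemma lenS_powR_compl k : len k.+1 `^ (1 - c) <= slack k.
Proof.
have c1 : 0 < 1 - c by rewrite subr_gt0 cdim_lt1.
rewrite lenS -powR_mulrn ?(ltW (slack_gt0 k))// -powRrM.
apply: ge1r_powR; first by rewrite slack_gt0 slack_le1.
have := truncnS_gt (1 - c)^-1; rewrite -/growth => h.
have : (1 - c)^-1 * (1 - c) <= (k + growth)%:R * (1 - c).
  by rewrite ler_pM2r// natrD ltW// ltr_wpDl.
by rewrite mulVf// gt_eqF.
Qed.

Lemma lenS_powR_small e : 0 < e ->
  exists k0, forall k, (k0 <= k)%N -> len k.+1 `^ e <= slack k.
Proof.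
move=> e0; exists (Num.truncn e^-1).+1 => k k0.
rewrite lenS -powR_mulrn ?(ltW (slack_gt0 k))// -powRrM.
apply: ge1r_powR; first by rewrite slack_gt0 slack_le1.
have h := truncnS_gt e^-1.
have : e^-1 * e <= (k + growth)%:R * e.
  rewrite ler_pM2r// (le_trans (ltW h))// ler_nat.
  by apply: (leq_trans k0); exact: leq_addr.
by rewrite mulVf// gt_eqF.
Qed.

Lemma lenS_powRc_gt0 k : 0 < len k.+1 `^ c.
Proof. by rewrite powR_gt0 ?len_gt0. Qed.

Lemma gap_gt0 k : 0 < gap k.
Proof. by rewrite divr_gt0 ?mulr_gt0 ?len_gt0 ?lenS_powRc_gt0. Qed.

Lemma gap_mul k : gap k * k.+2%:R * 4 = len k * len k.+1 `^ c.
Proof.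
rewrite /gap; have := ltr0Sn R k.+1; move: (k.+2%:R) => K K0.
by field; rewrite gt_eqF.
Qed.

Lemma gap_slack k : gap k = 2 ^+ k.+1 * slack k * len k.+1 `^ c.
Proof.
rewrite /gap /slack exprS; have := ltr0Sn R k.+1; move: (k.+2%:R) => K K0.
by have := pow2_gt0 k; move: (2 ^+ k) => p p0; field; rewrite !gt_eqF.
Qed.

Lemma lenS_powRc_le1 k : len k.+1 `^ c <= 1.
Proof.
rewrite -(powRr0 (len k.+1)); apply: ger_powR; last exact: cdim_ge0.
by rewrite len_gt0 len_le1.
Qed.

Lemma gap_le_len k : 8 * gap k <= len k.
Proof.
have := gap_mul k; have := kge1 k.+1; have := gap_gt0 k.
have := lenS_powRc_le1 k; have := len_gt0 k => l0 lc g0.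
have : (2 : R) <= k.+2%:R by rewrite ler_nat.
nra.
Qed.

Lemma lenS_le_gap k : 2 * len k.+1 <= gap k.
Proof.
have -> : len k.+1 = len k.+1 `^ c * len k.+1 `^ (1 - c).
  have := len_gt0 k.+1; move: (len k.+1) => l l0.
  rewrite -powRD; first by rewrite addrC subrK powRr1// ltW.
  by rewrite (gt_eqF l0) implybT.
rewrite gap_slack exprS; have := lenS_powR_compl k; have := pow2_ge1 k.
have := lenS_powRc_gt0 k; have := slack_gt0 k => s0 l0 p1 h.
have h1 : len k.+1 `^ c * len k.+1 `^ (1 - c) <= len k.+1 `^ c * slack k.
  by rewrite ler_pM2l.
have h2 : len k.+1 `^ c * slack k <= 2 ^+ k * (len k.+1 `^ c * slack k).
  by rewrite ler_peMl// mulr_ge0 ?ltW.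
lra.
Qed.

Lemma weight_gt0 k : 0 < weight k.
Proof. by rewrite mulr_gt0 ?slack_gt0. Qed.

Lemma weight_le k : weight k * 2 ^+ k <= 1.
Proof.
have -> : weight k * 2 ^+ k = len k / (4 * k.+2%:R).
  rewrite /weight /slack; have := ltr0Sn R k.+1; move: (k.+2%:R) => K K0.
  by have := pow2_gt0 k; move: (2 ^+ k) => p p0; field; rewrite !gt_eqF.
rewrite ler_pdivrMr//; have := len_le1 k; have := kge1 k.+1; lra.
Qed.

Lemma weight_powRc k : weight k * len k.+1 `^ c = gap k / 2 ^+ k.
Proof.
rewrite gap_slack exprS /weight.
by have := pow2_gt0 k; move: (2 ^+ k) => p p0; field; rewrite gt_eqF.
Qed.

End scales.

#[global] Opaque len slack gap weight.

(** * The Cantor set of a cell *)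

Section cantor_set.
Context {R : realType} (B : cell R).
Local Notation a := (hmin B).
Local Notation b := (hmax B).
Local Notation c := (cdim B).
Local Notation u := (cleft B).
Local Notation v := (cright B).
Local Notation len := (len B).
Local Notation gap := (gap B).
Local Notation weight := (weight B).

(** For each k the values of expo k are k + 2 equally spaced points from a to b,
    each of them taken once in every block of k + 2 consecutive indices. *)
Definition expo (k i : nat) : R := a + (b - a) * ((i %% k.+2)%:R / k.+1%:R).

Lemma expoE k i :
  expo k i = a + (b - a) * ((i %% k.+2)%:R / k.+1%:R).
Proof. by []. Qed.

Lemma expo_itv k i : a <= expo k i <= b.
Proof.
have ab := hmin_le_hmax B.
have h0 : 0 <= (i %% k.+2)%:R / k.+1%:R :> R by rewrite divr_ge0.
have h1 : (i %% k.+2)%:R / k.+1%:R <= 1 :> R.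
  by rewrite ler_pdivrMr// mul1r ler_nat -ltnS ltn_mod.
by rewrite /expo; move: (_ / _) h0 h1 => t h0 h1; apply/andP; split; nra.
Qed.

Lemma expo_ge0 k i : 0 <= expo k i.
Proof.
have := expo_itv k i; have := cdim_ge0 B; have := cdim_le_hmin B; lra.
Qed.

Lemma expo_le1 k i : expo k i <= 1.
Proof. have := expo_itv k i; have := hmax_le1 B; lra. Qed.

Definition cell_itv (k i : nat) : set R :=
  `[i%:R * gap k, i%:R * gap k + len k.+1].

Lemma cell_itvP k i x :
  cell_itv k i x <-> i%:R * gap k <= x <= i%:R * gap k + len k.+1.
Proof. by rewrite /cell_itv /= in_itv. Qed.

Lemma cell_itv_left k i : cell_itv k i (i%:R * gap k).
Proof. by apply/cell_itvP; rewrite lexx lerDl ltW ?len_gt0. Qed.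

Lemma cell_itv_right k i : cell_itv k i (i%:R * gap k + len k.+1).
Proof. by apply/cell_itvP; rewrite lexx lerDl ltW ?len_gt0. Qed.

(** Generation k lives in level k.+1; an interval of the grid is kept as soon as
    it fits in the previous level. *)
Fixpoint level (k : nat) : set R :=
  if k is j.+1 then \bigcup_(i in [set i | cell_itv j i `<=` level j]) cell_itv j i
  else `[u, v].

Definition active k i := cell_itv k i `<=` level k.

Definition cantor : set R := \bigcap_k level k.

Lemma level0 x : level 0 x <-> u <= x <= v.
Proof. by rewrite /= in_itv. Qed.

Lemma levelS k x : level k.+1 x <-> exists2 i, active k i & cell_itv k i x.
Proof. by split=> -[i ki xi]; exists i. Qed.

Lemma level_nincr j k : (j <= k)%N -> level k `<=` level j.
Proof.
elim: k => [|k IH]; first by rewrite leqn0 => /eqP ->.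
rewrite leq_eqVlt => /predU1P[->//|]; rewrite ltnS => /IH kj.
by move=> x /levelS[i ki xi]; exact/kj/ki.
Qed.

Lemma level_cell k x : level k x -> u <= x <= v.
Proof. by move/(@level_nincr 0) => /(_ (leq0n k))/level0. Qed.

Lemma active_cell k i : active k i ->
  u <= i%:R * gap k /\ i%:R * gap k + len k.+1 <= v.
Proof.
move=> ki; have /level_cell/andP[h1 _] := ki _ (cell_itv_left k i).
by have /level_cell/andP[_ h2] := ki _ (cell_itv_right k i).
Qed.

Definition grid_size k : nat := (Num.truncn (gap k)^-1).+1.

Lemma active_grid_size k i : active k i -> (i < grid_size k)%N.
Proof.
move=> /active_cell[_ h]; have g0 := gap_gt0 B k.
have i0 : (0 : R) <= i%:R by [].
rewrite ltnS truncn_ge_nat ?invr_ge0 ?ltW//.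
rewrite -[ltRHS]div1r ltr_pdivlMr//.
have := cright_le1 B; have := len_gt0 B k.+1; lra.
Qed.

Lemma grid_size_gap k : (grid_size k)%:R * gap k <= 2.
Proof.
have g0 := gap_gt0 B k; rewrite /grid_size -natr1 mulrDl mul1r.
have : (Num.truncn (gap k)^-1)%:R * gap k <= 1.
  by rewrite -ler_pdivlMr// div1r truncn_le invr_ge0 ltW.
have := gap_le_len B k; have := len_le1 B k; lra.
Qed.

Lemma closed_level k : closed (level k).
Proof.
elim: k => [|k IH]; first exact: itv_closed.
rewrite (_ : level k.+1 = \bigcup_(i in [set i | active k i]) cell_itv k i) //.
apply: closed_bigcup; last by move=> i _; exact: itv_closed.
apply: (@sub_finite_set _ _ `I_(grid_size k)); last exact: finite_II.
by move=> i /= /active_grid_size.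
Qed.

Lemma closed_cantor : closed cantor.
Proof. by apply: closed_bigI => k _; exact: closed_level. Qed.

Lemma cantor_cell x : cantor x -> u <= x <= v.
Proof. by move=> /(_ 0%N I)/level_cell. Qed.

Lemma cantorP x : cantor x <-> forall k, exists2 i, active k i & cell_itv k i x.
Proof.
split=> [Kx k|Kx k _]; first by apply/levelS; exact: (Kx k.+1 I).
by have [i ki xi] := Kx k; exact: ki.
Qed.

(** The intervals fill at most half of the grid step, so that the gaps between
    them are at least half of it. *)
Lemma cell_itv_ball_uniq k i j (x y r : R) :
  cell_itv k i x -> cell_itv k j y -> 2 * r <= gap k ->
  `|x - y| < r -> j = i.
Proof.
move=> /cell_itvP/andP[x1 x2] /cell_itvP/andP[y1 y2] rg; rewrite ltr_norml => /andP[d1 d2].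
have l0 := lenS_le_gap B k; have g0 := gap_gt0 B k; have p0 := len_gt0 B k.+1.
have H : forall m n : nat, (m < n)%N -> m%:R * gap k + gap k <= n%:R * gap k.
  by move=> m n mn; rewrite -{2}(mul1r (gap k)) -mulrDl ler_pM2r// natr1 ler_nat.
by case: (ssrnat.ltngtP i j) => // /H ?; exfalso; lra.
Qed.

End cantor_set.
#[global] Opaque level.

(** * The measure carried by a cell *)

Section cell_measure.
Context {R : realType} (B : cell R).
Local Notation a := (hmin B).
Local Notation b := (hmax B).
Local Notation c := (cdim B).
Local Notation u := (cleft B).
Local Notation v := (cright B).
Local Notation len := (len B).
Local Notation gap := (gap B).
Local Notation weight := (weight B).
Local Notation expo := (expo B).
Local Notation cell_itv := (cell_itv B).
Local Notation active := (active B).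
Local Notation level := (level B).
Local Notation cantor := (cantor B).
Local Notation grid_size := (grid_size B).
Local Notation leb := (@lebesgue_measure R).

Definition density k i : R :=
  if `[< active k i >] then weight k * len k.+1 `^ (expo k i - 1) else 0.

Lemma density_ge0 k i : 0 <= density k i.
Proof.
by rewrite /density; case: ifP => // _; rewrite mulr_ge0 ?powR_ge0// ltW ?weight_gt0.
Qed.

Lemma measurable_cell_itv k i : measurable (cell_itv k i : set (measurableTypeR R)).
Proof. exact: measurable_itv. Qed.

Definition gen_measure k : {measure set (measurableTypeR R) -> \bar R} :=
  msum (fun i => mscale (NngNum (density_ge0 k i))
                        (mrestr leb (measurable_cell_itv k i))) (grid_size k).

Definition cell_measure : {measure set (measurableTypeR R) -> \bar R} :=
  mseries gen_measure 0.

Lemma gen_measureE k A : gen_measure k A =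
  (\sum_(i < grid_size k) (density k i)%:E * leb (A `&` cell_itv k i))%E.
Proof. by []. Qed.

Lemma cell_measureE A : cell_measure A = (\sum_(k <oo) gen_measure k A)%E.
Proof. by []. Qed.

Lemma leb_cell_itv k i : leb (cell_itv k i) = (len k.+1)%:E.
Proof.
rewrite /cell_itv lebesgue_measure_itv/= lte_fin ltrDl len_gt0.
by rewrite -EFinD addrAC subrr add0r.
Qed.

Lemma leb_cell_itvI k i (A : set (measurableTypeR R)) : measurable A ->
  (leb (A `&` cell_itv k i) <= (len k.+1)%:E)%E.
Proof.
move=> mA; rewrite -(leb_cell_itv k i); have mI := measurable_cell_itv k i.
by apply: le_measure; rewrite ?inE//; exact: measurableI.
Qed.

Lemma density_len k i : active k i ->
  density k i * len k.+1 = weight k * len k.+1 `^ expo k i.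
Proof.
move=> ki; rewrite /density asboolT//; have l0 := len_gt0 B k.+1.
move: (len _) l0 => l l0; rewrite -mulrA; congr (_ * _).
rewrite -{2}(powRr1 (ltW l0)) -powRD; first by rewrite subrK.
by rewrite (gt_eqF l0) implybT.
Qed.

(** This is where cdim <= hmin is needed: len k.+1 ^ expo <= len k.+1 ^ c. *)
Lemma density_len_le k i : density k i * len k.+1 <= gap k / 2 ^+ k.
Proof.
have [ki|ki] := pselect (active k i); last first.
  rewrite /density asboolF// mul0r divr_ge0// ?exprn_ge0//.
  exact: ltW (gap_gt0 _ _).
rewrite density_len// -weight_powRc ler_pM2l ?weight_gt0//.
apply: ger_powR; first by rewrite len_gt0 len_le1.
have := cdim_le_hmin B; have /andP[] := expo_itv B k i; lra.
Qed.

Lemma count_grid_le (d lo hi : R) n : 0 < d -> lo - d <= hi ->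
  \sum_(i < n) (if lo <= i%:R * d <= hi then 1 else 0) <= (hi - lo) / d + 1.
Proof.
move=> d0; elim: n hi => [|n IH] hi lohi.
  rewrite big_ord0 -(ler_pM2r d0) mul0r mulrDl mul1r divfK ?gt_eqF//; lra.
rewrite big_ord_recr/=; case: ifPn => [/andP[lo1 hi1]|_]; last first.
  by rewrite addr0; exact: IH.
have h : lo - d <= hi - d by lra.
have -> : (hi - lo) / d + 1 = ((hi - d) - lo) / d + 1 + 1.
  by field; rewrite gt_eqF.
rewrite lerD2r; apply: le_trans (IH _ h); apply: ler_sum => i _.
case: ifPn => [/andP[l1 l2]|_]; last by case: ifP.
have id : (i%:R + 1) * d <= n%:R * d by rewrite ler_pM2r// natr1 ler_nat.
by rewrite l1 (_ : i%:R * d <= hi - d)//; lra.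
Qed.

(** By [density_len_le] the mass of generation k is at most 2 ^ (- k) times the
    length of the part of the grid that carries it; the term gap k accounts for
    the last grid point. *)
Lemma gen_measure_le k (A : set (measurableTypeR R)) (lo hi : R) : measurable A ->
  lo - gap k <= hi ->
  (forall i, active k i -> A `&` cell_itv k i !=set0 ->
    lo <= i%:R * gap k <= hi) ->
  (gen_measure k A <= ((hi - lo + gap k) / 2 ^+ k)%:E)%E.
Proof.
move=> mA lohi H; rewrite gen_measureE; have g0 := gap_gt0 B k.
have p0 : 0 < (2 ^+ k : R) by rewrite exprn_gt0.
apply: (@le_trans _ _ (\sum_(i < grid_size k)
    ((gap k / 2 ^+ k) * (if lo <= i%:R * gap k <= hi then 1 else 0))%:E)%E).
  apply: lee_sum => i _.
  have term0 : (0 <= ((gap k / 2 ^+ k) *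
      (if lo <= i%:R * gap k <= hi then 1 else 0))%:E)%E.
    by rewrite lee_fin; apply: mulr_ge0; [rewrite divr_ge0 ?ltW|case: ifP].
  have [ki|ki] := pselect (active k i); last first.
    by rewrite /density asboolF// mul0e.
  have [AI|AI] := pselect (A `&` cell_itv k i !=set0); last first.
    rewrite (_ : A `&` _ = set0) ?measure0 ?mule0//.
    by apply/eqP/negPn/negP => /set0P.
  rewrite (H _ ki AI) mulr1; apply: le_trans (_ : (density k i * len k.+1)%:E <= _)%E.
    by rewrite EFinM lee_pmul ?lee_fin ?density_ge0 ?leb_cell_itvI.
  by rewrite lee_fin density_len_le.
rewrite sumEFin lee_fin -mulr_sumr.
have -> : (hi - lo + gap k) / 2 ^+ k = gap k / 2 ^+ k * ((hi - lo) / gap k + 1).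
  by move: (2 ^+ k) (gap k) p0 g0 => p d ? ?; field; rewrite !gt_eqF.
by rewrite (ler_pM2l (divr_gt0 g0 p0)); exact: count_grid_le.
Qed.

Lemma gen_measure_total k : (gen_measure k setT <= (2 * (v - u) / 2 ^+ k)%:E)%E.
Proof.
have g0 := gap_gt0 B k; have gl := gap_le_len B k; have l0 := len_le_len0 B k.
have lg := len_gt0 B k; have lg1 := len_gt0 B k.+1.
apply: le_trans (_ : ((v - u + gap k) / 2 ^+ k)%:E <= _)%E.
  apply: gen_measure_le => //; first by lra.
  by move=> i /active_cell[? ?] _; apply/andP; split; lra.
rewrite lee_fin ler_pM2r ?invr_gt0 ?exprn_gt0//; lra.
Qed.

Lemma gen_measure_ball_large k x r : 0 < r -> gap k <= 2 * r ->
  (gen_measure k (ball x r) <= (8 * r / 2 ^+ k)%:E)%E.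
Proof.
move=> r0 gr; have g0 := gap_gt0 B k; have lg := lenS_le_gap B k.
have l0 := len_gt0 B k.+1.
apply: le_trans (_ : ((x + r - (x - r - len k.+1) + gap k) / 2 ^+ k)%:E <= _)%E.
  apply: gen_measure_le => //; [exact: measurable_realfun.measurable_ball|lra|].
  move=> i _ [y [+ /cell_itvP/andP[y1 y2]]]; rewrite /ball/= ltr_norml => /andP[? ?].
  by apply/andP; split; lra.
rewrite lee_fin ler_pM2r ?invr_gt0 ?exprn_gt0//; lra.
Qed.

Lemma leb_ball x r : 0 < r -> leb (ball x r) = (2 * r)%:E.
Proof.
move=> r0; rewrite lebesgue_measure_ball ?ltW//.
by rewrite mulr_natl.
Qed.

Lemma leb_ballI_le k i x r : 0 < r ->
  (leb (ball x r `&` cell_itv k i) <= (2 * r)%:E)%E.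
Proof.
move=> r0; rewrite -(leb_ball x r0).
have mb : measurable (ball x r : set (measurableTypeR R)).
  by exact: measurable_realfun.measurable_ball.
apply: le_measure; rewrite ?inE//.
by apply: measurableI => //; exact: measurable_cell_itv.
Qed.

(** The mass of the single interval met by the ball is proportional to
    min (r, l) * l ^ (h - 1) with l = len k.+1, and since h <= 1 this is at most
    r ^ h for both r <= l and r >= l. *)
Lemma gen_measure_ball_small k i x r : 0 < r -> 2 * r <= gap k ->
  active k i -> cell_itv k i x ->
  (gen_measure k (ball x r) <= (2 * weight k * r `^ expo k i)%:E)%E.
Proof.
move=> r0 rg ki xi; rewrite gen_measureE (bigD1 (Ordinal (active_grid_size ki)))//=.
rewrite big1 ?adde0; last first.
  move=> j /eqP ji; rewrite (_ : _ `&` _ = set0) ?measure0 ?mule0//.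
  rewrite -subset0 => y [xy yj]; apply: ji; apply: val_inj => /=.
  by apply: (cell_itv_ball_uniq xi yj rg); exact: xy.
have w0 := weight_gt0 B k; have l0 := len_gt0 B k.+1.
have e0 := expo_ge0 B k i; have e1 := expo_le1 B k i.
have mb : measurable (ball x r : set (measurableTypeR R)).
  by exact: measurable_realfun.measurable_ball.
have [rl|lr] := leP r (len k.+1); last first.
  apply: le_trans (_ : (density k i * len k.+1)%:E <= _)%E.
    by rewrite EFinM lee_pmul ?lee_fin ?density_ge0 ?leb_cell_itvI.
  rewrite lee_fin density_len// -mulrA mulrCA ler_pM2l//.
  have : len k.+1 `^ expo k i <= r `^ expo k i.
    by apply: ge0_ler_powR; rewrite ?nnegrE//; exact: ltW.
  have : 0 <= r `^ expo k i by exact: powR_ge0.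
  lra.
apply: le_trans (_ : (density k i * (2 * r))%:E <= _)%E.
  by rewrite EFinM lee_pmul ?lee_fin ?density_ge0 ?leb_ballI_le.
rewrite lee_fin /density asboolT//.
have -> : weight k * len k.+1 `^ (expo k i - 1) * (2 * r) =
  2 * weight k * (len k.+1 `^ (expo k i - 1) * r) by ring.
rewrite (ler_pM2l (mulr_gt0 (ltr0Sn _ 1) w0)).
have -> : r `^ expo k i = r `^ (expo k i - 1) * r.
  rewrite -{3}(powRr1 (ltW r0)) -powRD ?subrK//.
  by rewrite (gt_eqF r0) implybT.
rewrite ler_pM2r//.
have -> : expo k i - 1 = - (1 - expo k i) by ring.
rewrite !powRN lef_pV2 ?posrE ?powR_gt0//.
by apply: ge0_ler_powR; rewrite ?nnegrE ?subr_ge0//; exact: ltW.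
Qed.

Lemma gen_measure_ball_lin k : exists2 C, 0 <= C & forall x r, 0 < r ->
  (gen_measure k (ball x r) <= (C * r)%:E)%E.
Proof.
exists (\sum_(i < grid_size k) density k i * 2).
  by apply: sumr_ge0 => i _; rewrite mulr_ge0 ?density_ge0.
move=> x r r0; rewrite gen_measureE mulr_suml -sumEFin; apply: lee_sum => i _.
by rewrite -mulrA EFinM lee_pmul ?lee_fin ?density_ge0 ?leb_ballI_le.
Qed.

Lemma gen_measure_ball_in k i x r :
  0 < r -> r <= 1 -> active k i -> cell_itv k i x ->
  (gen_measure k (ball x r) <= (8 * r `^ expo k i / 2 ^+ k)%:E)%E.
Proof.
move=> r0 r1 ki xi; have p0 : 0 < (2 ^+ k : R) by rewrite exprn_gt0.
have [rg|/ltW gr] := leP (2 * r) (gap k).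
  apply: (le_trans (gen_measure_ball_small r0 rg ki xi)).
  rewrite lee_fin ler_pdivlMr// mulrAC ler_wpM2r ?powR_ge0//.
  have := weight_le B k; lra.
apply: (le_trans (gen_measure_ball_large _ r0 gr)).
rewrite lee_fin ler_pM2r ?invr_gt0// ler_pM2l//.
rewrite -[leLHS](powRr1 (ltW r0)); apply: ger_powR; rewrite ?expo_le1//.
by rewrite r0.
Qed.

Lemma gen_measure_disjoint k (A : set (measurableTypeR R)) :
  A `&` level k `<=` set0 -> gen_measure k A = 0%E.
Proof.
move=> Ak; rewrite gen_measureE big1// => i _.
have [ki|ki] := pselect (active k i); last by rewrite /density asboolF// mul0e.
rewrite (_ : _ `&` _ = set0) ?measure0 ?mule0// -subset0 => y [Ay yi].
by apply: (Ak y); split => //; exact: ki.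
Qed.

Lemma cell_measure_disjoint (A : set (measurableTypeR R)) :
  A `&` `[u, v] `<=` set0 -> cell_measure A = 0%E.
Proof.
move=> A0; rewrite cell_measureE eseries0// => k _ _; apply: gen_measure_disjoint.
by move=> x [Ax /level_cell xuv]; apply: (A0 x); split => //=; rewrite in_itv.
Qed.

Lemma nneseries_geometric_le (f : nat -> \bar R) (e : R) : 0 <= e ->
  (forall k, 0 <= f k)%E ->
  (forall k, (f k <= (e / 2 ^+ k)%:E)%E) ->
  (\sum_(k <oo) f k <= (2 * e)%:E)%E.
Proof.
move=> e0 f0 fe.
apply: (@le_trans _ _ (\sum_(k <oo) ((2 * e) / (2 ^ k.+1)%:R)%:E)%E).
  apply: lee_nneseries => k _ //.
  rewrite (le_trans (fe k))// lee_fin natrX exprS invfM mulrACA mulfV//.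
  by rewrite mul1r.
by apply: epsilon_trick0; rewrite mulr_ge0.
Qed.

Lemma cell_measure_total : (cell_measure setT <= (4 * (v - u))%:E)%E.
Proof.
have uv := cleft_lt_cright B.
rewrite cell_measureE (_ : 4 * _ = 2 * (2 * (v - u))); last by ring.
by apply: nneseries_geometric_le => // [|k]; [lra|exact: gen_measure_total].
Qed.

(** Finitely many generations have a bounded density, hence only the tail of
    the series matters. *)
Lemma cell_measure_ball_tail x eta rho k0 D : eta <= 1 -> 0 <= D ->
  (forall k r, (k0 <= k)%N -> 0 < r -> r < rho -> r < 1 ->
    (gen_measure k (ball x r) <= (D * r `^ eta / 2 ^+ k)%:E)%E) ->
  exists2 C, 0 <= C & forall r, 0 < r -> r < rho -> r < 1 ->
    (cell_measure (ball x r) <= (C * r `^ eta)%:E)%E.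
Proof.
move=> eta1 D0 H.
have [C C0 HC] : {C : nat -> R & forall k, 0 <= C k & forall k x r, 0 < r ->
    (gen_measure k (ball x r) <= (C k * r)%:E)%E}.
  have [C HC] := @choice _ _ (fun k C => 0 <= C /\ forall x r, 0 < r ->
    (gen_measure k (ball x r) <= (C * r)%:E)%E)
    (fun k => let: ex_intro2 C C0 HC := gen_measure_ball_lin k in
      ex_intro _ C (conj C0 HC)).
  by exists C => [k|k]; have [] := HC k.
pose M := \sum_(k < k0) C k * 2 ^+ k + D.
have S0 : 0 <= \sum_(k < k0) C k * 2 ^+ k.
  by apply: sumr_ge0 => k _; rewrite mulr_ge0 ?C0 ?exprn_ge0.
have M0 : 0 <= M by rewrite addr_ge0.
exists (2 * M); first by rewrite mulr_ge0.
move=> r r0 rrho r1; rewrite -mulrA cell_measureE.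
have re0 := powR_ge0 r eta.
apply: nneseries_geometric_le => // [|k]; first by rewrite mulr_ge0.
have p0 : 0 < (2 ^+ k : R) by rewrite exprn_gt0.
have [kk0|kk0] := ltnP k k0; last first.
  apply: (le_trans (H k r kk0 r0 rrho r1)).
  by rewrite lee_fin ler_pM2r ?invr_gt0// ler_wpM2r// /M lerDr.
apply: (le_trans (HC k x r r0)); rewrite lee_fin ler_pdivlMr//.
have rr : r <= r `^ eta.
  rewrite -{1}(powRr1 (ltW r0)); apply: ger_powR => //.
  by rewrite r0 ltW.
have Ck : C k * 2 ^+ k <= M.
  rewrite /M (bigD1 (Ordinal kk0))//= -addrA lerDl addr_ge0//.
  by apply: sumr_ge0 => j _; rewrite mulr_ge0 ?C0 ?exprn_ge0.
rewrite mulrAC ler_pM// ?mulr_ge0 ?C0 ?ltW//.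
Qed.

Lemma cell_measure_ball_in x eta k0 : cantor x -> eta <= 1 ->
  (forall k i, (k0 <= k)%N -> active k i -> cell_itv k i x -> eta <= expo k i) ->
  exists2 C, 0 <= C & forall r, 0 < r -> r < 1 ->
    (cell_measure (ball x r) <= (C * r `^ eta)%:E)%E.
Proof.
move=> Kx eta1 H.
have [|C C0 HC] := @cell_measure_ball_tail x eta 1 k0 8 eta1 (ler0n _ _).
  move=> k r kk0 r0 _ r1; have [i ki xi] := (cantorP B x).1 Kx k.
  apply: (le_trans (gen_measure_ball_in r0 (ltW r1) ki xi)).
  rewrite lee_fin ler_pM2r ?invr_gt0 ?exprn_gt0// ler_pM2l//.
  by apply: ger_powR; [rewrite r0 ltW|exact: H xi].
by exists C => // r r0 r1; exact: HC.
Qed.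

Lemma cell_measure_ball_out x : ~ cantor x ->
  exists C rho, [/\ 0 <= C, 0 < rho & forall r, 0 < r -> r < rho ->
    (cell_measure (ball x r) <= (C * r)%:E)%E].
Proof.
move=> /existsNP[k0 /not_implyP[_ xk0]].
have : open (~` level k0) by apply/closed_openC/closed_level.
rewrite openE => /(_ x xk0) /nbhs_ballP[rho /= rho0 Hrho].
have [|C C0 HC] := @cell_measure_ball_tail x 1 rho k0 0 (lexx 1) (lexx 0).
  move=> k r kk0 r0 rrho r1; rewrite gen_measure_disjoint ?lee_fin ?mul0r//.
  move=> y [xy yk]; apply: (Hrho y); last exact: (level_nincr kk0).
  exact: (le_ball (ltW rrho)).
exists C, (Num.min rho 1); split => //; first by rewrite lt_min rho0 ltr01.
move=> r r0; rewrite lt_min => /andP[r1 r2].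
by have := HC r r0 r1 r2; rewrite powRr1// ltW.
Qed.

Lemma cell_measure_ball_ge k i x : active k i -> cell_itv k i x ->
  ((weight k * len k.+1 `^ expo k i)%:E <=
    cell_measure (ball x (2 * len k.+1)%R))%E.
Proof.
move=> ki xi; have l0 := len_gt0 B k.+1.
pose D := ball x (2 * len k.+1); rewrite -/D cell_measureE.
apply: (@le_trans _ _ (gen_measure k D)); last first.
  rewrite -[leLHS]add0e.
  apply: (@le_trans _ _ (\sum_(0 <= j < k.+1) gen_measure j D)%E).
    by rewrite big_nat_recr//= leeD2r// sume_ge0.
  exact: nneseries_lim_ge.
rewrite gen_measureE (bigD1 (Ordinal (active_grid_size ki)))//=.
rewrite -density_len// -[leLHS]adde0 leeD ?sume_ge0//; last first.
  by move=> j _; rewrite mule_ge0 ?lee_fin ?density_ge0.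
rewrite (_ : _ `&` _ = cell_itv k i); first by rewrite leb_cell_itv EFinM.
apply/seteqP; split => [y []//|y yi]; split => //.
move: xi yi => /cell_itvP/andP[? ?] /cell_itvP/andP[? ?].
by rewrite /D /ball/= ltr_norml; apply/andP; split; lra.
Qed.

End cell_measure.

(** * The Cantor sets are small *)

Section cantor_dimension.
Context {R : realType} (B : cell R).
Local Notation a := (hmin B).
Local Notation b := (hmax B).
Local Notation c := (cdim B).
Local Notation len := (len B).
Local Notation gap := (gap B).
Local Notation slack := (slack B).
Local Notation cell_itv := (cell_itv B).
Local Notation level := (level B).
Local Notation cantor := (cantor B).
Local Notation grid_size := (grid_size B).

(** grid_size k * len k.+1 ^ c is at most 1 / slack k, and half of the exponent
    s - c pays for each of the two factors slack k. *)
Lemma grid_size_lenS_powR_small s : c < s ->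
  exists k0, forall k, (k0 <= k)%N -> (grid_size k)%:R * len k.+1 `^ s <= slack k.
Proof.
move=> cs; have e0 : 0 < (s - c) / 2 by rewrite divr_gt0 ?subr_gt0.
have [k0 Hk0] := lenS_powR_small B e0; exists k0 => k /Hk0.
have l0 := len_gt0 B k.+1; have s0 := slack_gt0 B k.
have lc := lenS_powRc_gt0 B k.
have -> : len k.+1 `^ s = len k.+1 `^ c * (len k.+1 `^ ((s - c) / 2)) ^+ 2.
  move: (len k.+1) l0 => l l0; rewrite expr2 -!powRD ?(gt_eqF l0) ?implybT//.
  by congr (_ `^ _); field.
have : 0 <= len k.+1 `^ ((s - c) / 2) by exact: powR_ge0.
move: (len k.+1 `^ ((s - c) / 2)) => t t0 ts.
have ng : (grid_size k)%:R * (slack k * len k.+1 `^ c) <= 1.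
  have := grid_size_gap B k; rewrite gap_slack exprS => h.
  have p1 : (1 : R) <= 2 ^+ k by rewrite exprn_ege1// ler1n.
  have h0 : 0 <= (grid_size k)%:R * (slack k * len k.+1 `^ c).
    by rewrite mulr_ge0// mulr_ge0// ltW.
  have : (grid_size k)%:R * (slack k * len k.+1 `^ c) <=
      2 ^+ k * ((grid_size k)%:R * (slack k * len k.+1 `^ c)) by rewrite ler_peMl.
  lra.
have t2 : t ^+ 2 <= slack k * slack k by rewrite expr2 ler_pM.
have : (grid_size k)%:R * len k.+1 `^ c * t ^+ 2 <=
    (grid_size k)%:R * len k.+1 `^ c * (slack k * slack k).
  by rewrite ler_wpM2l// mulr_ge0// ltW.
have : slack k * ((grid_size k)%:R * (slack k * len k.+1 `^ c)) <= slack k * 1.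
  by rewrite ler_pM2l.
lra.
Qed.

Lemma slack_small e : 0 < e ->
  exists k0, forall k, (k0 <= k)%N -> slack k <= e.
Proof.
move=> e0; have [N _ HN] := near_infty_natSinv_expn_lt (PosNum e0).
exists N => k /HN /= /ltW; rewrite div1r; apply: le_trans; exact: slack_le_pow.
Qed.

Lemma hausdorff_cantor_eq0 s : c < s -> hausdorff_measure s cantor = 0%E.
Proof.
move=> cs; have s0 : 0 <= s by rewrite ltW// (le_lt_trans (cdim_ge0 B)).
apply/hausdorff_measure_eq0P => d e d0 e0.
have [k1 H1] := grid_size_lenS_powR_small cs.
have [k2 H2] := slack_small d0; have [k3 H3] := slack_small e0.
pose k := maxn k1 (maxn k2 k3).
have {}H1 := H1 k (leq_maxl _ _).
have {}H2 := H2 k (leq_trans (leq_maxl _ _) (leq_maxr _ _)).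
have {}H3 := H3 k (leq_trans (leq_maxr _ _) (leq_maxr _ _)).
exists (fun i => if (i < grid_size k)%N then cell_itv k i else set0); split.
- move=> x /cantorP/(_ k)[i ki xi]; exists i => //.
  by rewrite (active_grid_size ki).
- move=> i; case: ifP => _; last first.
    by apply: ge_ereal_sup => ? [? []].
  have lp := len_gt0 B k.+1.
  apply: (le_trans (diam_itv _)); first by rewrite lerDl ltW.
  rewrite lee_fin addrAC subrr add0r (le_trans _ H2)//.
  exact: lenS_le_slack.
- rewrite (@nneseries_split _ _ 0 (grid_size k)); last by move=> i _; exact: gauge_ge0.
  rewrite [X in (_ + X)%E]eseries0 ?adde0; last first.
    by move=> i; rewrite add0n leqNgt => /negbTE -> _; exact: gauge_set0.
  rewrite add0n big_mkord (le_trans _ (_ : (slack k)%:E <= _)%E) ?lee_fin//.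
  apply: (@le_trans _ _ (\sum_(i < grid_size k) (len k.+1 `^ s)%:E)%E).
    apply: lee_sum => i _; rewrite ltn_ord.
    have lp := len_gt0 B k.+1.
    apply: (le_trans (gauge_itv_le s0 _)); first by rewrite lerDl ltW.
    by rewrite addrAC subrr add0r.
  by rewrite sumEFin lee_fin sumr_const card_ord -mulr_natl.
Qed.

Lemma lebesgue_cantor_eq0 : lebesgue_measure (cantor : set (measurableTypeR R)) = 0%E.
Proof.
apply/eqP; rewrite eq_le measure_ge0 andbT; apply/lee_addgt0Pr => e e0.
rewrite add0e.
have [k1 H1] := grid_size_lenS_powR_small (cdim_lt1 B).
have [k3 H3] := slack_small e0.
pose k := maxn k1 k3.
have {}H1 := H1 k (leq_maxl _ _); have {}H3 := H3 k (leq_maxr _ _).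
apply: (@le_trans _ _ (\sum_(i < grid_size k) lebesgue_measure (cell_itv k i))%E).
  apply: content_subadditive => [i _||].
  - exact: measurable_cell_itv.
  - by apply: measurable_realfun.closed_measurable; exact: closed_cantor.
  - move=> x /cantorP/(_ k)[i ki xi]; rewrite -bigcup_mkord.
    by exists i => //=; exact: active_grid_size.
under eq_bigr do rewrite leb_cell_itv.
rewrite sumEFin lee_fin sumr_const card_ord -mulr_natl.
by apply: le_trans H3; move: H1; rewrite powRr1// ltW// len_gt0.
Qed.

End cantor_dimension.

(** * The level sets inside a Cantor set are large *)

Section holder_parametrization.
Context {R : realType} (B : cell R).
Local Notation a := (hmin B).
Local Notation b := (hmax B).
Local Notation c := (cdim B).
Local Notation u := (cleft B).
Local Notation v := (cright B).
Local Notation len := (len B).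
Local Notation gap := (gap B).
Local Notation expo := (expo B).
Local Notation cell_itv := (cell_itv B).
Local Notation active := (active B).
Local Notation level := (level B).
Local Notation cantor := (cantor B).

(** The distance between consecutive grid points of the same residue class. *)
Definition step k : R := k.+2%:R * gap k.

(** The number of children kept in each interval: one step is lost for starting
    in the interval and at most one for the residue, whence the subtraction. *)
Definition arity k : nat := (Num.truncn (4 / len k.+1 `^ c) - 2)%N.

Lemma step_gt0 k : 0 < step k.
Proof. by rewrite mulr_gt0 ?gap_gt0. Qed.

Lemma gap_le_step k : gap k * 2 <= step k.
Proof.
rewrite /step mulrC; have := gap_gt0 B k => g0.
by rewrite ler_pM2r// ler_nat.
Qed.

Lemma step_mul k : 4 * step k = len k * len k.+1 `^ c.
Proof. by rewrite -gap_mul /step; ring. Qed.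

Lemma arity_bounds k : [/\ (2 <= arity k)%N,
  step k * ((arity k)%:R + 2) <= len k & 1 <= (arity k)%:R * len k.+1 `^ c].
Proof.
have lc := lenS_powRc_gt0 B k; have lc1 := lenS_powRc_le1 B k.
have st := step_mul k; have st0 := step_gt0 k.
rewrite /arity; move: (len k.+1 `^ c) lc lc1 st => t t0 t1 st.
have p : (4 : R) <= 4 / t by rewrite ler_pdivlMr//; lra.
have n4 : (4 <= Num.truncn (4 / t))%N by rewrite truncn_ge_nat//; lra.
have /andP[h1 h2] := truncn_itv (le_trans (ler0n _ 4) p).
have n2 : (2 <= Num.truncn (4 / t))%N by exact: leq_trans n4.
have h1' : (Num.truncn (4 / t))%:R * t <= 4 by rewrite -ler_pdivlMr.
have h2' : 4 < ((Num.truncn (4 / t))%:R + 1) * t.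
  by rewrite -ltr_pdivrMr// natr1.
split.
- by rewrite -(leq_add2r 2) subnK.
- rewrite natrB// subrK; move: (Num.truncn _)%:R h1' => n h1'.
  rewrite -(ler_pM2r t0); nra.
- by rewrite natrB//; nra.
Qed.

Lemma arity_step k : len k <= 4 * ((arity k)%:R * step k).
Proof.
have [_ _ h] := arity_bounds k; have l0 := len_gt0 B k.
have -> : 4 * ((arity k)%:R * step k) = (arity k)%:R * (4 * step k) by ring.
rewrite step_mul mulrCA; have : len k * 1 <= len k * ((arity k)%:R * len k.+1 `^ c).
  by rewrite ler_pM2l.
by rewrite mulr1.
Qed.

Section sequences_of_children.
Context (t : R) (t01 : 0 <= t <= 1).

(** The residue whose exponent is closest to a + (b - a) * t from below. *)
Definition residue k : nat := Num.truncn (t * k.+1%:R).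

Lemma residue_lt k : (residue k < k.+2)%N.
Proof.
have /andP[t0 t1] := t01.
rewrite /residue truncn_lt_nat ?mulr_ge0//.
have : (0 : R) < k.+1%:R by [].
by rewrite -(natr1 k.+1) => ?; nra.
Qed.

(** The index of the interval of generation k reached by following the choices
    j 0, .., j k: skip the grid points before the left end of the parent, then
    take the j k-th point with the prescribed residue. *)
Fixpoint child (j : nat -> nat) k : nat :=
  let parent_left := if k is m.+1 then (child j m)%:R * gap m else u in
  (k.+2 * ((Num.truncn (parent_left / step k)).+1 + j k) + residue k)%N.

Definition parent_left (j : nat -> nat) k : R :=
  if k is m.+1 then (child j m)%:R * gap m else u.

Lemma childE j k : child j k =
  (k.+2 * ((Num.truncn (parent_left j k / step k)).+1 + j k) + residue k)%N.
Proof. by case: k. Qed.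

Lemma parent_left_ge0 j k : 0 <= parent_left j k.
Proof.
case: k => [|k] /=; first exact: cleft_ge0.
by rewrite mulr_ge0// ltW// gap_gt0.
Qed.

Lemma child_in_parent j k : (j k < arity k)%N ->
  parent_left j k <= (child j k)%:R * gap k /\
  (child j k)%:R * gap k + len k.+1 <= parent_left j k + len k.
Proof.
move=> jk; have g0 := gap_gt0 B k; have s0 := step_gt0 k.
have [_ ha _] := arity_bounds k.
have lg := lenS_le_gap B k; have l1 := len_gt0 B k.+1.
have q0 : 0 <= parent_left j k / step k by rewrite divr_ge0 ?parent_left_ge0// ltW.
have /andP[h1 h2] := truncn_itv q0.
have {}h1 : (Num.truncn (parent_left j k / step k))%:R * step k <= parent_left j k.
  by rewrite -ler_pdivlMr.
have {}h2 : parent_left j k <= ((Num.truncn (parent_left j k / step k))%:R + 1) * step k.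
  by rewrite -ler_pdivrMr// natr1 ltW.
have -> : (child j k)%:R * gap k =
    ((Num.truncn (parent_left j k / step k))%:R + 1) * step k + (j k)%:R * step k
    + (residue k)%:R * gap k.
  by rewrite childE natrD natrM natrD -natr1 /step; ring.
have hr : ((residue k)%:R + 1) * gap k <= step k.
  by rewrite /step ler_pM2r// natr1 ler_nat residue_lt.
have hj : ((j k)%:R + 1) * step k <= (arity k)%:R * step k.
  by rewrite ler_pM2r// natr1 ler_nat.
have j0 : 0 <= (j k)%:R * step k by rewrite mulr_ge0// ltW.
have r0 : 0 <= (residue k)%:R * gap k by rewrite mulr_ge0// ltW.
by split; lra.
Qed.

Lemma child_active j k : (forall m, j m < arity m)%N -> active k (child j k).
Proof.
move=> jM; elim: k => [|k IH] x /cell_itvP /andP[x1 x2].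
  have [h1 h2] := @child_in_parent j 0 (jM 0%N).
  move: h1 h2; rewrite len0 /parent_left => h1 h2.
  by apply/level0/andP; split; lra.
apply/levelS; exists (child j k) => //; apply/cell_itvP.
have [h1 h2] := @child_in_parent j k.+1 (jM _).
by move: h1 h2; rewrite /parent_left => ? ?; apply/andP; split; lra.
Qed.

Definition branch_point (j : nat -> nat) : R :=
  sup (range (fun k => (child j k)%:R * gap k)).

Lemma child_nested j k m x : (forall m, j m < arity m)%N -> (k <= m)%N ->
  cell_itv m (child j m) x -> cell_itv k (child j k) x.
Proof.
move=> jM; elim: m => [|m IH]; first by rewrite leqn0 => /eqP ->.
rewrite leq_eqVlt => /predU1P[->//|]; rewrite ltnS => /IH h /cell_itvP/andP[x1 x2].
apply/h/cell_itvP; have [] := @child_in_parent j m.+1 (jM _).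
by rewrite /parent_left => ? ?; apply/andP; split; lra.
Qed.

Lemma branch_point_itv j k :
  (forall m, j m < arity m)%N -> cell_itv k (child j k) (branch_point j).
Proof.
move=> jM.
have ub : ubound (range (fun m => (child j m)%:R * gap m))
    ((child j k)%:R * gap k + len k.+1).
  move=> _ [m _ <-]; have [mk|/ltnW km] := leqP m k.
    have /cell_itvP/andP[+ _] := child_nested jM mk (cell_itv_left B k (child j k)).
    by have := len_gt0 B k.+1; lra.
  by have /cell_itvP/andP[] := child_nested jM km (cell_itv_left B m (child j m)).
apply/cell_itvP/andP; split.
  apply: sup_ubound; last by exists k.
  by exists ((child j k)%:R * gap k + len k.+1).
apply: ge_sup => //; by exists ((child j k)%:R * gap k), k.
Qed.

Lemma branch_point_cantor j : (forall m, j m < arity m)%N -> cantor (branch_point j).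
Proof.
move=> jM; apply/cantorP => k; exists (child j k); first exact: child_active.
exact: branch_point_itv.
Qed.

Lemma parent_left_agree j j' k : (forall m, (m < k)%N -> j m = j' m) ->
  parent_left j k = parent_left j' k.
Proof.
elim: k => [//|k IH] jj'; rewrite /parent_left !childE jj'// IH// => m mk.
by apply: jj'; exact: ltnW.
Qed.

Lemma natr_dist_ge1 (m n : nat) : m <> n -> 1 <= `|m%:R - n%:R : R|.
Proof.
wlog mn : m n / (m < n)%N => [H mn|_].
  by case: (ssrnat.ltngtP m n) => // ?; [|rewrite distrC]; apply: H => // /esym.
have : (m%:R + 1 : R) <= n%:R by rewrite natr1 ler_nat.
rewrite distrC => ?; apply: le_trans (ler_norm _); lra.
Qed.

(** Branches that separate in generation k have a common interval of length
    len k, and the left ends of their next intervals differ by a nonzero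
    multiple of the step, while an interval is shorter than half a step. *)
Lemma branch_point_dist j j' k :
  (forall m, j m < arity m)%N -> (forall m, j' m < arity m)%N ->
  (forall m, (m < k)%N -> j m = j' m) -> j k <> j' k ->
  step k * `|(j k)%:R - (j' k)%:R| <= 2 * `|branch_point j - branch_point j'| /\
  `|branch_point j - branch_point j'| <= len k.
Proof.
move=> jM j'M jj' jk; have bE := parent_left_agree jj'.
have /cell_itvP/andP[x1 x2] := branch_point_itv k jM.
have /cell_itvP/andP[y1 y2] := branch_point_itv k j'M.
have [bx1 bx2] := child_in_parent (jM k); have [by1 by2] := child_in_parent (j'M k).
split; last by rewrite ler_norml; apply/andP; split; lra.
have lg := lenS_le_gap B k; have gs := gap_le_step k; have l1 := len_gt0 B k.+1.
have s0 := step_gt0 k.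
have dE : (child j k)%:R * gap k - (child j' k)%:R * gap k =
    step k * ((j k)%:R - (j' k)%:R).
  by rewrite !childE bE !natrD !natrM !natrD /step; ring.
have h1 : 1 <= `|(j k)%:R - (j' k)%:R : R|.
  exact: natr_dist_ge1.
have dE' : step k * `|(j k)%:R - (j' k)%:R| =
    `|(child j k)%:R * gap k - (child j' k)%:R * gap k|.
  by rewrite dE normrM gtr0_norm.
have h2 : step k * 1 <= step k * `|(j k)%:R - (j' k)%:R| by rewrite ler_pM2l.
have : `|(child j k)%:R * gap k - (child j' k)%:R * gap k| <=
    `|branch_point j - branch_point j'| + len k.+1.
  by rewrite ler_norml; have := ler_norm (branch_point j - branch_point j');
   have := ler_norm (- (branch_point j - branch_point j')); rewrite normrN => ? ?;
   apply/andP; split; lra.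
lra.
Qed.
End sequences_of_children.

Definition arity_prod k : nat := \prod_(m < k) arity m.

(** Mixed radix expansion with radices arity 0, arity 1, .. *)
Definition digit (y : R) k : nat :=
  (Num.truncn ((arity_prod k.+1)%:R * y) %% arity k)%N.

Lemma arity_prodS k : arity_prod k.+1 = (arity_prod k * arity k)%N.
Proof. by rewrite /arity_prod big_ord_recr. Qed.

Lemma arity_gt0 k : (0 < arity k)%N.
Proof. by have [/(leq_trans _)->] := arity_bounds k. Qed.

Lemma arity_prod_ge k : (2 ^ k <= arity_prod k)%N.
Proof.
elim: k => [|k IH]; first by rewrite /arity_prod big_ord0.
by rewrite arity_prodS expnSr leq_mul//; have [] := arity_bounds k.
Qed.

Lemma digit_lt y k : (digit y k < arity k)%N.
Proof. by rewrite ltn_mod arity_gt0. Qed.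

Lemma truncn_mul_nat (m : nat) (z : R) : (0 < m)%N -> 0 <= z ->
  (Num.truncn (m%:R * z) %/ m)%N = Num.truncn z.
Proof.
move=> m0 z0; have m0' : (0 : R) < m%:R by rewrite ltr0n.
have /truncn_itv/andP[h1 h2] : 0 <= m%:R * z by rewrite mulr_ge0.
set q := Num.truncn (m%:R * z) in h1 h2 *.
apply/esym/truncn_def/andP; split.
  rewrite -(ler_pM2l m0'); apply: le_trans h1.
  by rewrite -natrM ler_nat mulnC leq_divM.
rewrite -(ltr_pM2l m0'); apply: lt_le_trans h2 _.
by rewrite -natrM ler_nat mulnC ltn_ceil.
Qed.

Lemma truncn_digit y k : 0 <= y -> Num.truncn ((arity_prod k.+1)%:R * y) =
  (Num.truncn ((arity_prod k)%:R * y) * arity k + digit y k)%N.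
Proof.
move=> y0; rewrite {1}(divn_eq (Num.truncn _) (arity k)); congr (_ * _ + _)%N.
rewrite arity_prodS mulnC natrM -mulrA truncn_mul_nat ?arity_gt0//.
by rewrite mulr_ge0.
Qed.

Lemma digits_agree y z k : 0 <= y < 1 -> 0 <= z < 1 ->
  (forall m, (m < k)%N -> digit y m = digit z m) ->
  Num.truncn ((arity_prod k)%:R * y) = Num.truncn ((arity_prod k)%:R * z).
Proof.
move=> /andP[y0 y1] /andP[z0 z1]; elim: k => [|k IH] yz.
  have t0 x : 0 <= x -> x < 1 -> Num.truncn ((arity_prod 0)%:R * x) = 0%N.
    by move=> x0 x1; rewrite /arity_prod big_ord0 mul1r; apply: truncn_def; rewrite x0.
  by rewrite !t0.
rewrite !truncn_digit// yz// IH// => m mk; apply: yz; exact: ltnW.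
Qed.

Lemma dist_truncn (q y z : R) : 0 <= q * y -> 0 <= q * z -> 0 <= q ->
  q * `|y - z| <= `|(Num.truncn (q * y))%:R - (Num.truncn (q * z))%:R| + 1.
Proof.
move=> /truncn_itv/andP[y1 y2] /truncn_itv/andP[z1 z2] q0.
move: y2 z2; rewrite -!natr1 => y2 z2.
rewrite -{1}(ger0_norm q0) -normrM mulrBr ler_norml.
move: (Num.truncn _)%:R (Num.truncn _)%:R y1 y2 z1 z2 => n m ? ? ? ?.
have := ler_norm (m - n); have := ler_norm (- (m - n)); rewrite normrN => ? ?.
by apply/andP; split; lra.
Qed.

Lemma digits_differ y z : 0 <= y < 1 -> 0 <= z < 1 -> y <> z ->
  exists k, digit y k <> digit z k.
Proof.
move=> y01 z01 yz; apply: contrapT => /forallNP same; apply: yz.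
have {}same k : digit y k = digit z k by apply: contrapT; exact: same.
apply/eqP; rewrite -subr_eq0 -normr_eq0 eq_le normr_ge0 andbT.
apply/ler_addgt0Pr => e e0; rewrite add0r.
have [N _ HN] := near_infty_natSinv_expn_lt (PosNum e0).
have /= := HN N (leqnn N); rewrite div1r => /ltW; apply: le_trans.
have T0 : (0 : R) < (arity_prod N)%:R.
  by rewrite ltr0n (leq_trans _ (arity_prod_ge N))// expn_gt0.
have Th : (2 : R) ^+ N <= (arity_prod N)%:R by rewrite -natrX ler_nat arity_prod_ge.
have p0 : (0 : R) < 2 ^+ N by rewrite exprn_gt0.
have /andP[y0 _] := y01; have /andP[z0 _] := z01.
have := @dist_truncn (arity_prod N)%:R y z (mulr_ge0 (ltW T0) y0)
  (mulr_ge0 (ltW T0) z0) (ltW T0).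
rewrite (@digits_agree y z N)// subrr normr0 add0r => h.
rewrite -[leRHS]mulr1 -ler_pdivrMl ?invr_gt0// invrK.
by apply: le_trans h; rewrite ler_wpM2r.
Qed.

Lemma arity_prod_len k : len 0 `^ c <= (arity_prod k)%:R * len k `^ c.
Proof.
case: k => [|k]; first by rewrite /arity_prod big_ord0 mul1r.
have [_ _ h] := arity_bounds k.
have : len 0 `^ c <= 1.
  rewrite -(powRr0 (len 0)); apply: ger_powR; last exact: cdim_ge0.
  by rewrite len_gt0 len_le1.
move=> /le_trans; apply; apply: (le_trans h).
rewrite ler_wpM2r ?powR_ge0// arity_prodS ler_nat leq_pmull//.
by rewrite (leq_trans _ (arity_prod_ge k))// expn_gt0.
Qed.

(** If the expansions of y and z differ first at k, in digits n apart, then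
    |y - z| is at most 2 * n / arity_prod k.+1 while the points are n * step k
    apart up to a factor 2. Since arity k * step k is comparable with len k, this
    gives |y - z| <= 16 * rho / (arity_prod k * len k); as rho <= len k, one may
    trade rho / len k for (rho / len k) ^ c, and arity_prod k is at least
    len k ^ (- c) up to a constant by [arity_prod_len]. *)
Lemma branch_point_holder t y z : 0 <= t <= 1 -> 0 <= y < 1 -> 0 <= z < 1 ->
  `|y - z| <= 16 / len 0 `^ c *
    `|branch_point t (digit y) - branch_point t (digit z)| `^ c.
Proof.
move=> t01 y01 z01.
have V0 : 0 < len 0 `^ c by rewrite powR_gt0// len_gt0.
have [->|/eqP yz] := eqVneq y z.
  by rewrite subrr normr0 mulr_ge0 ?divr_ge0 ?powR_ge0.
have exk : exists k, digit y k != digit z k.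
  by have [k /eqP] := digits_differ y01 z01 yz; exists k.
case: (ex_minnP exk) => k /eqP jk jmin.
have jj m : (m < k)%N -> digit y m = digit z m.
  by move=> mk; apply/eqP; apply: contraLR mk => /jmin; rewrite -leqNgt.
have [] := branch_point_dist t01 (digit_lt y) (digit_lt z) jj jk.
set rho := `|branch_point _ _ - _| => h1 h2.
have /andP[y0 _] := y01; have /andP[z0 _] := z01.
have := @dist_truncn (arity_prod k.+1)%:R y z (mulr_ge0 (ler0n _ _) y0)
  (mulr_ge0 (ler0n _ _) z0) (ler0n _ _).
rewrite !truncn_digit// (digits_agree y01 z01 jj) !natrD opprD addrACA subrr add0r.
set n := `|(digit y k)%:R - _| in h1 * => h3.
have n1 : 1 <= n by exact: natr_dist_ge1.
set d := `|y - z| in h3 *.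
have d0 : 0 <= d by exact: normr_ge0.
have rho0 : 0 <= rho by exact: normr_ge0.
rewrite arity_prodS natrM in h3.
have l0 := len_gt0 B k; have s0 := step_gt0 k; have ha := arity_step k.
have T0 : (0 : R) <= (arity_prod k)%:R by [].
(* 16 = 2 * 2 * 4: from n + 1 <= 2 * n, branch_point_dist and arity_step *)
have h4 : (arity_prod k)%:R * len k * d <= 16 * rho.
  have : step k * ((arity_prod k)%:R * (arity k)%:R * d) <= step k * (n + 1).
    by rewrite ler_pM2l.
  have : (arity_prod k)%:R * d * len k <=
      (arity_prod k)%:R * d * (4 * ((arity k)%:R * step k)).
    by rewrite ler_wpM2l// mulr_ge0.
  have : step k * 1 <= step k * n by rewrite ler_pM2l.
  lra.
have c1 : 0 <= 1 - c by rewrite subr_ge0 ltW// cdim_lt1.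
have L1 : 0 < len k `^ (1 - c) by rewrite powR_gt0.
have lE : len k = len k `^ c * len k `^ (1 - c).
  move: (len k) l0 => l l0.
  rewrite -powRD; first by rewrite addrC subrK powRr1// ltW.
  by rewrite (gt_eqF l0) implybT.
have rE : rho <= rho `^ c * len k `^ (1 - c).
  have [r0|rn0] := eqVneq rho 0.
    by rewrite [leLHS]r0 mulr_ge0 ?powR_ge0// ltW.
  have rp : 0 < rho by rewrite lt0r rn0.
  have rr : rho = rho `^ c * rho `^ (1 - c) :> R.
    rewrite -powRD; first by rewrite addrC subrK powRr1.
    by rewrite rn0 implybT.
  rewrite [leLHS]rr ler_wpM2l ?powR_ge0//; apply: ge0_ler_powR; rewrite ?nnegrE//.
  exact: ltW.
have tl : len 0 `^ c <= (arity_prod k)%:R * len k `^ c by exact: arity_prod_len.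
rewrite mulrAC ler_pdivlMr// -(ler_pM2r L1).
have h5 : d * len 0 `^ c * len k `^ (1 - c) <=
    d * ((arity_prod k)%:R * len k `^ c) * len k `^ (1 - c).
  by rewrite ler_pM2r// ler_wpM2l.
have : (arity_prod k)%:R * len k * d =
    d * ((arity_prod k)%:R * len k `^ c) * len k `^ (1 - c).
  by rewrite {1}lE; ring.
lra.
Qed.


(** By [cell_itv_ball_uniq] there is only one such i for each k when x is in the
    Cantor set. *)
Definition expo_cvg (x h : R) := forall e, 0 < e -> exists k0, forall k i,
  (k0 <= k)%N -> active k i -> cell_itv k i x -> `|expo k i - h| <= e.

Lemma branch_point_expo t (j : nat -> nat) : 0 <= t <= 1 ->
  (forall m, j m < arity m)%N -> expo_cvg (branch_point t j) (a + (b - a) * t).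
Proof.
move=> t01 jM e e0.
have [N _ HN] := near_infty_natSinv_lt (PosNum e0).
exists N => k i Nk ki xi.
have xk := branch_point_itv t01 k jM; have g0 := gap_gt0 B k.
have -> : i = child t j k.
  apply: (cell_itv_ball_uniq xk xi (r := gap k / 2)); first by rewrite mulrC divfK.
  by rewrite subrr normr0 divr_gt0.
have -> : expo k (child t j k) = a + (b - a) * ((residue t k)%:R / k.+1%:R).
  by rewrite expoE childE mulnC modnMDl modn_small// residue_lt.
have := HN k Nk; rewrite /= => ke.
have k0 : (0 : R) < k.+1%:R by [].
have /andP[t0 _] := t01.
have /truncn_itv/andP[r1 r2] : 0 <= t * k.+1%:R by rewrite mulr_ge0.
move: r1 r2; rewrite -/(residue t k) -(natr1 (residue t k)) => r1 r2.
have ab := hmin_le_hmax B; have a0 := le_trans (cdim_ge0 B) (cdim_le_hmin B).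
have b1 := hmax_le1 B.
set q := _ / _.
have qt : q <= t by rewrite /q ler_pdivrMr.
have tq : t <= q + e.
  apply: (@le_trans _ _ (q + k.+1%:R^-1)); last by rewrite lerD2l ltW.
  have -> : q + k.+1%:R^-1 = ((residue t k)%:R + 1) / k.+1%:R.
    by rewrite /q mulrDl mul1r.
  by rewrite ler_pdivlMr// ltW.
by rewrite ler_norml; apply/andP; split; nra.
Qed.

Lemma cantor_holder h : a <= h <= b -> exists C, exists x : R -> R,
  [/\ 0 < C, forall y, 0 <= y < 1 -> cantor (x y) /\ expo_cvg (x y) h &
    forall y z, 0 <= y < 1 -> 0 <= z < 1 ->
      `|y - z| <= C * `|x y - x z| `^ c].
Proof.
move=> /andP[ah hb].
have [t [t01 ->]] : exists t, 0 <= t <= 1 /\ h = a + (b - a) * t.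
  have [ab|ab] := eqVneq a b.
    by exists 0; rewrite lexx ler01; split=> //; move: ah hb; rewrite ab; lra.
  have ab0 : 0 < b - a by rewrite subr_gt0 lt_neqAle ab hmin_le_hmax.
  exists ((h - a) / (b - a)); split; last by rewrite mulrC divfK ?gt_eqF//; ring.
  apply/andP; split; first by rewrite divr_ge0 ?subr_ge0 ?hmin_le_hmax.
  by rewrite ler_pdivrMr// mul1r lerD2r.
exists (16 / len 0 `^ c), (fun y => branch_point t (digit y)); split.
- by rewrite divr_gt0// powR_gt0// len_gt0.
- move=> y _; split; first by apply: branch_point_cantor => // m; exact: digit_lt.
  by apply: branch_point_expo => // m; exact: digit_lt.
- by move=> y z; exact: branch_point_holder.
Qed.

End holder_parametrization.

(** * Assembling the cells *)

Section assembled_measure.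
Context {R : realType} (B : nat -> cell R).
Context (cleft_B : forall n, cleft (B n) = (2 ^+ n.+1)^-1).
Context (cright_B : forall n,
  cright (B n) = (2 ^+ n.+1)^-1 + (2 ^+ n.+1)^-1 ^+ 2).
Local Notation leb := (@lebesgue_measure R).
Local Notation T := (measurableTypeR R).
Implicit Types (x r e eta : R) (m n k i : nat).

Definition leb01 : {measure set T -> \bar R} :=
  mrestr leb (measurable_itv `[(0 : R), 1] : measurable (`[0, 1]%classic : set T)).

Definition cells : {measure set T -> \bar R} :=
  mseries (fun n => cell_measure (B n)) 0.

Definition mixture : {measure set T -> \bar R} := measure_add leb01 cells.

Lemma mixtureE A :
  mixture A = (leb (A `&` `[0%R, 1%R]%classic) + \sum_(n <oo) cell_measure (B n) A)%E.
Proof. exact: (measure_addE leb01 cells A). Qed.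

Let cleft_gt0 n : 0 < cleft (B n).
Proof. by rewrite cleft_B invr_gt0 exprn_gt0. Qed.

Let cleft_le_half n : cleft (B n) <= 2^-1.
Proof.
rewrite cleft_B lef_pV2 ?posrE ?exprn_gt0// exprS ler_peMr//.
by rewrite exprn_ege1// ler1n.
Qed.

Let cright_cleft n : cright (B n) = cleft (B n) + cleft (B n) ^+ 2.
Proof. by rewrite cright_B cleft_B. Qed.

Lemma cells_small e : 0 < e ->
  exists n0, forall n, (n0 <= n)%N -> cright (B n) < e.
Proof.
move=> e0; have [N _ HN] := near_infty_natSinv_expn_lt (PosNum e0).
exists N => n /HN /=; apply: le_lt_trans.
rewrite cright_cleft; have := cleft_le_half n; have := cleft_gt0 n.
have : 1 / 2 ^+ n = 2 * cleft (B n).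
  by rewrite cleft_B exprS invfM mulrA mulfV.
move: (cleft _) => l -> l0 l1; nra.
Qed.

Lemma cells_disjoint m n x : m != n ->
  cleft (B m) <= x <= cright (B m) -> cleft (B n) <= x <= cright (B n) -> False.
Proof.
wlog mn : m n / (m < n)%N => [H mn hm hn|_].
  move: (mn); rewrite neq_ltn => /orP[h|h]; first exact: (H m n).
  by apply: (H n m) => //; rewrite eq_sym.
move=> /andP[x1 _] /andP[_]; rewrite cright_cleft => x2.
have h := cleft_le_half n; have h0 := cleft_gt0 n.
have : 2 * cleft (B n) <= cleft (B m).
  rewrite !cleft_B exprS invfM mulrA mulfV// mul1r.
  by rewrite lef_pV2 ?posrE ?exprn_gt0// ler_weXn2l// ler1n.
nra.
Qed.

Lemma cantor_disjoint m n x : cantor (B m) x -> cantor (B n) x -> m = n.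
Proof.
move=> /cantor_cell xm /cantor_cell xn; apply: contrapT => /eqP mn.
exact: cells_disjoint mn xm xn.
Qed.

Lemma mixture_ball_ge x r : 0 <= x <= 1 -> 0 < r -> r <= 2^-1 ->
  (r%:E <= mixture (ball x r))%E.
Proof.
move=> /andP[x0 x1] r0 r1; rewrite mixtureE -[leLHS]adde0.
apply: leeD; last by apply: nneseries_ge0 => n _ _; exact: measure_ge0.
have mb : measurable (ball x r : set T) by exact: measurable_realfun.measurable_ball.
have [y [xy y0 y1]] : exists y, [/\ y <= x <= y + r, 0 <= y & y + r <= 1].
  have [xh|xh] := leP x 2^-1; first by exists x; split; [apply/andP; split|..]; lra.
  by exists (x - r); split; [apply/andP; split|..]; lra.
have -> : r%:E = leb (`]y, y + r[%classic : set T).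
  by rewrite lebesgue_measure_itv/= lte_fin ltrDl r0 -EFinD addrAC subrr add0r.
apply: le_measure; rewrite ?inE; [exact: measurable_itv| |].
  by apply: measurableI => //; exact: measurable_itv.
move=> z /=; rewrite !in_itv/= => /andP[z1 z2]; move: xy => /andP[h1 h2].
by split; [rewrite /ball/= ltr_norml|]; apply/andP; split; lra.
Qed.

Lemma leb01_ball_le x r : 0 < r ->
  (leb (ball x r `&` `[0%R, 1%R]%classic) <= (2 * r)%:E)%E.
Proof.
move=> r0; rewrite -(leb_ball x r0).
have mb : measurable (ball x r : set T) by exact: measurable_realfun.measurable_ball.
by apply: le_measure; rewrite ?inE//; apply: measurableI => //; exact: measurable_itv.
Qed.

(** Away from 0 only finitely many cells are close to x. *)
Lemma mixture_ball_le x eta : 0 < x -> eta <= 1 ->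
  (forall n, exists C rho, [/\ 0 <= C, 0 < rho & forall r, 0 < r -> r < rho ->
    (cell_measure (B n) (ball x r) <= (C * r `^ eta)%:E)%E]) ->
  exists C rho, [/\ 0 <= C, 0 < rho & forall r, 0 < r -> r < rho ->
    (mixture (ball x r) <= (C * r `^ eta)%:E)%E].
Proof.
move=> x0 eta1 H.
have [n0 Hn0] : exists n0, forall n, (n0 <= n)%N -> cright (B n) < x / 2.
  by apply: cells_small; rewrite divr_gt0.
have [C [rho [C0 rho0 HC]]] : exists C rho, [/\ 0 <= C, 0 < rho &
    forall r, 0 < r -> r < rho -> (\sum_(n < n0)
      cell_measure (B n) (ball x r) <= (C * r `^ eta)%:E)%E].
  elim: n0 {Hn0} => [|m [C [rho [C0 rho0 HC]]]].
    by exists 0, 1; split=> // r _ _; rewrite big_ord0 mul0r.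
  have [C' [rho' [C'0 rho'0 HC']]] := H m.
  exists (C + C'), (Num.min rho rho'); split; [exact: addr_ge0| |].
    by rewrite lt_min rho0.
  move=> r r0; rewrite lt_min => /andP[r1 r2]; rewrite big_ord_recr/= mulrDl EFinD.
  by apply: leeD; [exact: HC|exact: HC'].
exists (C + 2), (Num.min rho (Num.min (x / 2) 1)); split; [by rewrite addr_ge0| |].
  by rewrite !lt_min rho0 ltr01 divr_gt0.
move=> r r0; rewrite !lt_min => /and3P[r1 r2 r3].
rewrite mixtureE addrC mulrDl EFinD; apply: leeD; last first.
  apply: (le_trans (leb01_ball_le x r0)); rewrite lee_fin ler_pM2l//.
  by rewrite -{1}(powRr1 (ltW r0)); apply: ger_powR => //; rewrite r0 ltW.
rewrite (@nneseries_split _ _ 0 n0); last by move=> i _; exact: measure_ge0.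
rewrite [X in (_ + X)%E]eseries0 ?adde0; first by rewrite add0n big_mkord HC.
move=> i; rewrite add0n => /Hn0 hi _; apply: cell_measure_disjoint.
move=> y [+ yi]; move: yi; rewrite /= in_itv/= /ball/= ltr_norml.
by move=> /andP[? ?] /andP[? ?]; lra.
Qed.

(** A cell that meets the ball satisfies cleft < r, and its mass is at most
    4 * cleft ^ 2 <= 4 * cleft * r, where the cleft have sum 1. *)
Lemma mixture_ball0_le r : 0 < r -> (mixture (ball 0%R r) <= (6 * r)%:E)%E.
Proof.
move=> r0; rewrite mixtureE (_ : 6 * r = 2 * r + 2 * (2 * r)); last by ring.
rewrite EFinD; apply: leeD; first exact: leb01_ball_le.
apply: nneseries_geometric_le => // [|n]; first by rewrite mulr_ge0 ?ltW.
have [lr|rl] := ltP (cleft (B n)) r; last first.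
  rewrite cell_measure_disjoint ?lee_fin ?divr_ge0 ?mulr_ge0 ?(ltW r0) ?exprn_ge0//.
  move=> y [+ yi]; move: yi; rewrite /= in_itv/= /ball/= sub0r normrN.
  by move=> /andP[? ?] /(le_lt_trans (ler_norm _)); lra.
have mb : measurable (ball 0 r : set T) by exact: measurable_realfun.measurable_ball.
apply: (@le_trans _ _ (cell_measure (B n) setT)).
  by apply: le_measure; rewrite ?inE.
apply: (le_trans (cell_measure_total (B n))); rewrite lee_fin cright_cleft.
rewrite addrAC subrr add0r; have l0 := cleft_gt0 n.
have -> : 2 * r / 2 ^+ n = 4 * (cleft (B n) * r).
  by rewrite cleft_B exprS; field; rewrite expf_neq0.
by rewrite ler_pM2l// expr2 ler_pM2l// ltW.
Qed.

Lemma mixture_lty : (mixture setT < +oo)%E.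
Proof.
rewrite mixtureE; apply: lte_add_pinfty.
  by rewrite setTI lebesgue_measure_itv/= lte_fin ltr01 ltry.
apply: (@le_lt_trans _ _ (2 * 4)%:E); last exact: ltry.
apply: nneseries_geometric_le => // n.
apply: (le_trans (cell_measure_total (B n))); rewrite lee_fin cright_cleft.
rewrite addrAC subrr add0r ler_pM2l//.
have l0 := cleft_gt0 n; have l1 := cleft_le_half n.
have <- : 2 * cleft (B n) = (2 ^+ n)^-1.
  by rewrite cleft_B exprS invfM mulrA mulfV// mul1r.
nra.
Qed.

Lemma mixture_outside : mixture (~` `[0, 1]%classic) = 0%E.
Proof.
rewrite mixtureE setICl measure0 add0e eseries0// => n _ _.
apply: cell_measure_disjoint => x [/= x01 xn]; apply: x01; move: xn.
rewrite !in_itv/= => /andP[x1 x2]; have := cleft_ge0 (B n).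
by have := cright_le1 (B n) => ? ?; apply/andP; split; lra.
Qed.

Definition mass : R := fine (mixture setT).

Lemma mixture_mass : mixture setT = mass%:E.
Proof. by rewrite /mass fineK// ge0_fin_numE// mixture_lty. Qed.

Lemma mass_gt0 : 0 < mass.
Proof.
have h := @mixture_ball_ge 0 2^-1; have mb : measurable (ball (0:R) 2^-1 : set T).
  exact: measurable_realfun.measurable_ball.
have : (2^-1%:E <= mixture setT)%E.
  apply: (le_trans (h _ _ _)); rewrite ?lexx ?ler01 ?invr_gt0//.
  by apply: le_measure; rewrite ?inE.
by rewrite mixture_mass lee_fin; apply: lt_le_trans; rewrite invr_gt0.
Qed.

Definition mixture_proba : probability T R := mnormalize mixture (dirac (0 : T)).

Lemma mixture_probaE A : mixture_proba A = (mixture A * mass^-1%:E)%E.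
Proof.
rewrite /mixture_proba /= /mnormalize/= mixture_mass ifF//.
by rewrite eqe gt_eqF ?mass_gt0.
Qed.

Lemma mixture_proba_ball_ge x r (l : R) : (l%:E <= mixture (ball x r))%E ->
  ((mass^-1 * l)%:E <= mixture_proba (ball x r))%E.
Proof.
move=> h; rewrite mixture_probaE mulrC EFinM lee_pmul2r// lte_fin invr_gt0; exact: mass_gt0.
Qed.

Lemma mixture_proba_ball_le x r (l : R) : (mixture (ball x r) <= l%:E)%E ->
  (mixture_proba (ball x r) <= (mass^-1 * l)%:E)%E.
Proof.
move=> h; rewrite mixture_probaE mulrC EFinM lee_pmul2r// lte_fin invr_gt0; exact: mass_gt0.
Qed.

Lemma measure_supp_mixture_proba : measure_supp mixture_proba = `[0, 1]%classic.
Proof.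
apply/seteqP; split => x.
  move=> /(_ `[0, 1]%classic); apply; split; first exact: itv_closed.
  by have := mixture_probaE (~` `[0, 1]%classic); rewrite mixture_outside mul0e.
rewrite /= in_itv/= => x01 F [cF F0]; apply: contrapT => xF.
have : open (~` F) by exact: closed_openC.
rewrite openE => /(_ x xF) /nbhs_ballP[r /= r0 Hr].
pose s := Num.min r 2^-1.
have s0 : 0 < s by rewrite lt_min r0 invr_gt0/=.
have s1 : s <= 2^-1 by rewrite ge_min lexx orbT.
have := mixture_proba_ball_ge (mixture_ball_ge x01 s0 s1).
apply/negP; rewrite -ltNge (@le_lt_trans _ _ 0%E)//; last first.
  by rewrite lte_fin mulr_gt0// invr_gt0 mass_gt0.
rewrite -F0; apply: le_measure; rewrite ?inE.
- exact: measurable_realfun.measurable_ball.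
- by apply: measurableC; exact: measurable_realfun.closed_measurable.
- by apply: subset_trans Hr; apply: le_ball; rewrite ge_min lexx.
Qed.

Lemma in_measure_supp_mixture_proba x : 0 <= x <= 1 -> x \in measure_supp mixture_proba.
Proof. by move=> x01; rewrite measure_supp_mixture_proba inE /= in_itv. Qed.

Lemma mixture_proba_lty A : measurable A -> (mixture_proba A < +oo)%E.
Proof. by move=> mA; apply: le_lt_trans (probability_le1 _ mA) _; exact: ltry. Qed.

Lemma local_dim_le1 x : 0 <= x <= 1 -> (local_dim mixture_proba x <= 1)%E.
Proof.
move=> x01; apply: (@local_dim_le _ _ x 1 mass^-1); first exact: in_measure_supp_mixture_proba.
- by rewrite invr_gt0 mass_gt0.
- by move=> r; apply: mixture_proba_lty; exact: measurable_realfun.measurable_ball.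
move=> d d0; pose s := Num.min (d / 2) 2^-1.
have s0 : 0 < s by rewrite lt_min divr_gt0//= invr_gt0.
have sd : s < d by rewrite /s gt_min; apply/orP; left; lra.
exists s; first by rewrite s0.
rewrite powRr1 ?(ltW s0)//; apply: mixture_proba_ball_ge.
by apply: mixture_ball_ge => //; rewrite ge_min lexx orbT.
Qed.

Lemma local_dim_ge_of_mixture x eta : 0 <= x <= 1 ->
  (exists C rho, [/\ 0 <= C, 0 < rho & forall r, 0 < r -> r < rho ->
    (mixture (ball x r) <= (C * r `^ eta)%:E)%E]) ->
  (eta%:E <= local_dim mixture_proba x)%E.
Proof.
move=> x01 [C [rho [C0 rho0 HC]]].
apply: (@local_dim_ge _ _ x eta (mass^-1 * (C + 1))); first exact: in_measure_supp_mixture_proba.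
  by rewrite mulr_gt0 ?invr_gt0 ?mass_gt0// ltr_wpDl.
near=> r.
have r0 : 0 < r by near: r; exact: nbhs_right_gt.
have r1 : r < rho by near: r; exact: nbhs_right_lt.
have r2 : r <= 2^-1 by near: r; apply: nbhs_right_le; rewrite invr_gt0.
apply/andP; split.
  apply: lt_le_trans (mixture_proba_ball_ge (mixture_ball_ge x01 r0 r2)).
  by rewrite lte_fin mulr_gt0// invr_gt0 mass_gt0.
rewrite -mulrA; apply: mixture_proba_ball_le; apply: (le_trans (HC r r0 r1)).
by rewrite lee_fin ler_wpM2r ?powR_ge0// lerDl.
Unshelve. all: by end_near. Qed.

Lemma local_dim_out x : 0 <= x <= 1 -> (forall n, ~ cantor (B n) x) ->
  local_dim mixture_proba x = 1%E.
Proof.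
move=> x01 xK; apply/eqP; rewrite eq_le local_dim_le1//=.
apply: local_dim_ge_of_mixture => //; have [x0|x0] := eqVneq x 0.
  exists 6, 1; split => // r r0 _; rewrite x0 powRr1 ?(ltW r0)//.
  exact: mixture_ball0_le.
apply: mixture_ball_le => //; first by rewrite lt0r x0; case/andP: x01.
move=> n; have [C [rho [C0 rho0 HC]]] := cell_measure_ball_out (xK n).
by exists C, rho; split => // r r0 rr; rewrite powRr1 ?(ltW r0)//; exact: HC.
Qed.

Lemma cantor01 n x : cantor (B n) x -> 0 < x <= 1.
Proof.
move=> /cantor_cell/andP[x1 x2]; have := cleft_gt0 n; have := cright_le1 (B n).
by move=> ? ?; apply/andP; split; lra.
Qed.

(** The other cells and the finitely many first generations contribute O(r),
    which is O(r ^ eta) because eta <= 1. *)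
Lemma local_dim_in_ge n x eta k0 : cantor (B n) x -> eta <= 1 ->
  (forall k i, (k0 <= k)%N -> active (B n) k i -> cell_itv (B n) k i x ->
    eta <= expo (B n) k i) ->
  (eta%:E <= local_dim mixture_proba x)%E.
Proof.
move=> Kx eta1 H; have /andP[x0 x1] := cantor01 Kx.
apply: local_dim_ge_of_mixture; first by rewrite ltW.
apply: mixture_ball_le => // m; have [mn|mn] := eqVneq m n.
  have [C C0 HC] := cell_measure_ball_in Kx eta1 H.
  by exists C, 1; rewrite mn; split.
have nKx : ~ cantor (B m) x by move=> /(cantor_disjoint Kx) /esym/eqP; exact/negP.
have [C [rho [C0 rho0 HC]]] := cell_measure_ball_out nKx.
exists C, (Num.min rho 1); split => //; first by rewrite lt_min rho0 ltr01.
move=> r r0; rewrite lt_min => /andP[r1 r2]; apply: (le_trans (HC r r0 r1)).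
rewrite lee_fin ler_wpM2l// -{1}(powRr1 (ltW r0)).
by apply: ger_powR => //; rewrite r0 ltW.
Qed.

Lemma weight_ge (D : cell R) e : 0 < e ->
  exists k0, forall k, (k0 <= k)%N -> len D k.+1 `^ e <= weight D k.
Proof.
move=> /(lenS_powR_small D)[k0 Hk0]; exists k0 => k /Hk0 h.
have := slack_gt0 D k; rewrite -[weight D k]/(2 * slack D k); lra.
Qed.

Lemma lenS_small (D : cell R) e : 0 < e ->
  exists k0, forall k, (k0 <= k)%N -> len D k.+1 <= e.
Proof.
move=> /(slack_small D)[k0 Hk0]; exists k0 => k /Hk0; apply: le_trans.
exact: lenS_le_slack.
Qed.

(** The radii 2 * len k.+1 realise the exponents, up to the factor weight k; it
    is eventually larger than any given positive power of the radius. *)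
Lemma local_dim_in_le n x eta k0 : cantor (B n) x ->
  (forall k i, (k0 <= k)%N -> active (B n) k i -> cell_itv (B n) k i x ->
    expo (B n) k i <= eta) ->
  (local_dim mixture_proba x <= eta%:E)%E.
Proof.
move=> Kx H; have /andP[x0 x1] := cantor01 Kx.
apply/lee_addgt0Pr => e e0; rewrite -EFinD.
apply: (@local_dim_le _ _ x (eta + e) (mass^-1 * (2 `^ (eta + e))^-1)).
- by apply: in_measure_supp_mixture_proba; rewrite ltW.
- by rewrite mulr_gt0 ?invr_gt0 ?mass_gt0 ?powR_gt0.
- by move=> r; apply: mixture_proba_lty; exact: measurable_realfun.measurable_ball.
move=> d d0.
have [k1 Hk1] := weight_ge (B n) e0.
have [k2 Hk2] : exists k2, forall k, (k2 <= k)%N -> len (B n) k.+1 <= d / 3.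
  by apply: lenS_small; rewrite divr_gt0.
pose k := maxn k0 (maxn k1 k2); pose D := ball x (2 * len (B n) k.+1).
have {}H i := H k i (leq_maxl _ _).
have {}Hk1 := Hk1 k (leq_trans (leq_maxl _ _) (leq_maxr _ _)).
have {}Hk2 := Hk2 k (leq_trans (leq_maxr _ _) (leq_maxr _ _)).
have [i ki xi] := (cantorP (B n) x).1 Kx k.
have l0 := len_gt0 (B n) k.+1; have l1 := len_le1 (B n) k.+1.
exists (2 * len (B n) k.+1); first by apply/andP; split; lra.
rewrite -mulrA; apply: mixture_proba_ball_ge; rewrite -/D.
apply: (@le_trans _ _ (cell_measure (B n) D)); last first.
  rewrite mixtureE -[leLHS]add0e; apply: leeD => //.
  rewrite -[leLHS]add0e.
  apply: (@le_trans _ _ (\sum_(0 <= j < n.+1) cell_measure (B j) D)%E).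
    by rewrite big_nat_recr//= leeD2r// sume_ge0.
  exact: nneseries_lim_ge.
apply: le_trans (cell_measure_ball_ge ki xi); rewrite lee_fin.
have {}H := H i ki xi.
rewrite powRM ?(ltW l0)// mulrA mulVf ?mul1r ?gt_eqF ?powR_gt0//.
rewrite powRD ?(gt_eqF l0) ?implybT// mulrC.
apply: ler_pM; rewrite ?powR_ge0//.
by apply: ger_powR => //; rewrite l0.
Qed.

Lemma local_dim_in_itv n x : cantor (B n) x ->
  ((hmin (B n))%:E <= local_dim mixture_proba x <= (hmax (B n))%:E)%E.
Proof.
move=> Kx; have h1 := hmin_le_hmax (B n); have h2 := hmax_le1 (B n).
apply/andP; split.
  apply: (local_dim_in_ge (k0 := 0) Kx); first exact: le_trans h2.
  by move=> k i _ _ _; have /andP[] := expo_itv (B n) k i.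
apply: (local_dim_in_le (k0 := 0) Kx).
by move=> k i _ _ _; have /andP[] := expo_itv (B n) k i.
Qed.

Lemma local_dim_in_cvg n x h : cantor (B n) x -> h <= 1 ->
  expo_cvg (B n) x h -> local_dim mixture_proba x = h%:E.
Proof.
move=> Kx h1 xh; apply/eqP; rewrite eq_le; apply/andP; split.
  apply/lee_addgt0Pr => e e0; rewrite -EFinD.
  have [k0 Hk0] := xh e e0.
  apply: (local_dim_in_le (k0 := k0) Kx) => k i kk ki xi.
  by have := Hk0 k i kk ki xi; rewrite ler_norml => /andP[? ?]; lra.
apply/lee_subgt0Pr => e e0; rewrite -EFinB.
have [k0 Hk0] := xh e e0.
apply: (local_dim_in_ge (k0 := k0) Kx); first lra.
move=> k i kk ki xi.
by have := Hk0 k i kk ki xi; rewrite ler_norml => /andP[? ?]; lra.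
Qed.

End assembled_measure.

(** * The theorem *)

(** Completeness: L differs from the Borel set A by a subset of a null set. *)
Lemma lebesgue_measurable_squeeze {R : realType} (A L D : set R) :
  measurable (A : set (measurableTypeR R)) ->
  measurable (D : set (measurableTypeR R)) ->
  A `<=` L -> L `<=` D -> (lebesgue_measure D < +oo)%E ->
  lebesgue_measure (D `\` A) = 0%E ->
  lebesgue_measurable L /\ completed_lebesgue_measure L = lebesgue_measure D.
Proof.
move=> mA mD AL LD Doo DA0.
have sub (E : set R) : measurable (E : set (measurableTypeR R)) ->
  lebesgue_measurable E by exact: sub_caratheodory.
have mL : lebesgue_measurable L.
  have -> : L = A `|` (L `\` A).
    apply/seteqP; split => [x Lx|x [/AL//|[]//]].
    by have [Ax|nAx] := pselect (A x); [left|right].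
  rewrite /lebesgue_measurable; apply: measurableU; first exact: sub.
  apply: completed_lebesgue_measure_is_complete.
  exists (D `\` A); split; first by apply: sub; exact: measurableD.
    exact: DA0.
  by move=> x [/LD Dx nAx].
split=> //.
have AD : lebesgue_measure A = lebesgue_measure D.
  have := measureDI (@lebesgue_measure R) mD mA.
  by rewrite [X in (X + _)%E]DA0 add0e setIidr//; exact: subset_trans LD.
apply/eqP; rewrite eq_le; apply/andP; split.
  by apply: (le_measure (@completed_lebesgue_measure R)); rewrite ?inE//; exact: sub.
rewrite -AD.
by apply: (le_measure (@completed_lebesgue_measure R)); rewrite ?inE//; exact: sub.
Qed.

Section family.
Context {R : realType} (f : R -> \bar R) (fn : nat -> \bar R -> \bar R).
Context (a b : nat -> R) (Ff : F_family f fn a b).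
Local Open Scope ereal_scope.

Definition family_dim n : R := fine (fn n (a n)%:E).

Lemma family_itv n : [/\ (0 <= a n)%R, (a n <= b n)%R & (b n <= 1)%R].
Proof. by have [? []] := F_itv Ff n. Qed.

Lemma family_out n (h : R) : (0 <= h)%R -> ~ (a n <= h <= b n)%R ->
  fn n h%:E = -oo.
Proof.
move=> h0 hn; apply/eqP; rewrite -leeNy_eq leNgt; apply/negP => fnh.
have : fsupp `[0, +oo]%classic (fn n) h%:E.
  by split => //=; rewrite in_itv/= lee_fin h0 leey.
by rewrite (F_supp Ff) => -[y + [yh]]; rewrite yh /= in_itv.
Qed.

Lemma family_in n (h : R) : (a n <= h <= b n)%R ->
  [/\ fn n h%:E = (family_dim n)%:E, (0 <= family_dim n)%R
    & (family_dim n <= a n)%R].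
Proof.
move=> hn; have [a0 ab b1] := family_itv n.
have an : (a n \in `[a n, b n])%R by rewrite in_itv/= lexx.
have hn' : (h \in `[a n, b n])%R by rewrite in_itv.
rewrite (F_cst Ff hn' an).
have : fsupp `[0, +oo]%classic (fn n) (a n)%:E.
  by rewrite (F_supp Ff); exists (a n).
move=> [Da fa]; have := @F_valued _ _ _ _ _ Ff n _ Da; have := F_le Ff an.
rewrite /family_dim; move: fa; case: (fn n (a n)%:E) => [y| |]//= _.
by rewrite lee_fin => ya [//|/andP[]]; rewrite lee_fin.
Qed.

Lemma family_fsupp (h : R) :
  fsupp `[0%R, 1%R]%classic f h <-> exists n, (a n <= h <= b n)%R.
Proof.
split=> [[/= h01 fh]|[n hn]].
  apply: contrapT => /forallNP H; move: fh; rewrite (F_sup Ff h01).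
  rewrite ltNge => /negP; apply; apply: ge_ereal_sup => _ [n _ <-].
  by rewrite family_out//; move: h01; rewrite in_itv => /andP[].
have [a0 ab b1] := family_itv n; have /andP[ah hb] := hn.
have h01 : (h \in `[0, 1])%R.
  by rewrite in_itv/= (le_trans a0 ah) (le_trans hb b1).
split => //; rewrite (F_sup Ff h01); have [fnh _ _] := family_in hn.
apply: (@lt_le_trans _ _ (family_dim n)%:E); first exact: ltNyr.
by rewrite -fnh; apply: ereal_sup_ubound; exists n.
Qed.

(** If a n = 1 the interval I_n is {1}, where nothing is prescribed. As the
    lengths in a cell shrink fast enough only when cdim < 1, a cell of dimension
    0 with the single exponent 1 is then put in the n-th place. *)
Lemma family_cells : exists B : nat -> cell R, forall n,
  [/\ cleft (B n) = ((2 ^+ n.+1)^-1)%R,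
      cright (B n) = ((2 ^+ n.+1)^-1 + (2 ^+ n.+1)^-1 ^+ 2)%R,
      (a n < 1)%R -> [/\ hmin (B n) = a n, hmax (B n) = b n
                      & cdim (B n) = family_dim n]
    & (1 <= a n)%R -> hmin (B n) = 1%R /\ hmax (B n) = 1%R].
Proof.
suff /choice[B HB] : forall n, exists D : cell R,
    [/\ cleft D = ((2 ^+ n.+1)^-1)%R,
    cright D = ((2 ^+ n.+1)^-1 + (2 ^+ n.+1)^-1 ^+ 2)%R,
    (a n < 1)%R -> [/\ hmin D = a n, hmax D = b n & cdim D = family_dim n]
  & (1 <= a n)%R -> hmin D = 1%R /\ hmax D = 1%R] by exists B.
move=> n.
have p0 : (0 < (2 ^+ n.+1)^-1 :> R)%R by rewrite invr_gt0 exprn_gt0.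
have p1 : ((2 ^+ n.+1)^-1 <= 2^-1 :> R)%R.
  rewrite lef_pV2 ?posrE ?exprn_gt0// exprS ler_peMr//.
  by rewrite exprn_ege1// ler1n.
move: (_^-1)%R p0 p1 => p p0 p1.
have pp : (p < p + p ^+ 2)%R by rewrite ltrDl exprn_gt0.
have q1 : (p + p ^+ 2 <= 1)%R by nra.
have [a0 ab b1] := family_itv n.
have [_ h0 ha] : [/\ fn n (a n)%:E = (family_dim n)%:E, (0 <= family_dim n)%R
  & (family_dim n <= a n)%R] by apply: family_in; rewrite lexx.
have [a1|a1] := ltP (a n) 1%R; last first.
  exists (Cell (lexx 0%R) ltr01 ler01 (lexx 1%R) (lexx 1%R) (ltW p0) pp q1).
  by split.
exists (Cell h0 (le_lt_trans ha a1) ha ab b1 (ltW p0) pp q1).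
by split.
Qed.

End family.

Theorem theorem1p10 (R : realType) (f : R -> \bar R) (Ff : class_F f) :
  exists mu : probability (measurableTypeR R) R,
    [/\ measure_supp mu `<=` `[0, 1],
        forall h : R, (fsupp `[0, 1] f `\ 1) h -> spectrum mu h = f h,
        forall h : R, 0 <= h -> ~ (fsupp `[0, 1] f `|` [set 1]) h ->
          spectrum mu h = -oo%E,
        lebesgue_measurable (level_set mu 1) /\
          completed_lebesgue_measure (level_set mu 1) = 1%E
      & spectrum_supp mu = fsupp `[0, 1] f `|` [set 1]].
Proof.
have [fv [fn [a [b Fam]]]] := Ff.
have [B HB] := family_cells Fam.
have cl n : cleft (B n) = (2 ^+ n.+1)^-1 by have [] := HB n.
have cr n : cright (B n) = (2 ^+ n.+1)^-1 + (2 ^+ n.+1)^-1 ^+ 2 by have [] := HB n.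
pose mu := mixture_proba B.
pose K := \bigcup_n cantor (B n).
have lev_out x : 0 <= x <= 1 -> ~ K x -> local_dim mu x = 1%E.
  by move=> x01 nK; apply: (local_dim_out cl cr x01) => n Kx; apply: nK; exists n.
(* off the Cantor sets the local dimension is 1, and so it is on the cells with
   a n = 1 *)
have lev_in h x : h != 1 -> level_set mu h x ->
    exists n, [/\ a n <= h <= b n, a n < 1 & cantor (B n) x].
  move=> h1 [x01 xh]; have [[n _ Kx]|nK] := pselect (K x); last first.
    move: xh; rewrite lev_out//.
    by move=> [] /esym/eqP; rewrite (negbTE h1).
  have := local_dim_in_itv cl cr Kx; rewrite -/mu xh !lee_fin.
  have [_ _ H1 H2] := HB n; have [an|an] := ltP (a n) 1.
    by have [-> -> _] := H1 an => abh; exists n.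
  have [-> ->] := H2 an => /le_anti /esym hE.
  by move: h1; rewrite hE eqxx.
have supp1 h : h != 1 -> (exists n, a n <= h <= b n) ->
    (level_set mu h) !=set0 /\ forall n, a n <= h <= b n ->
    ((family_dim fn a n)%:E <= spectrum mu h)%E.
  move=> h1 exn.
  have low n : a n <= h <= b n -> level_set mu h !=set0 /\
      ((family_dim fn a n)%:E <= spectrum mu h)%E.
    move=> hn; have [_ ab b1] := family_itv Fam n.
    have hle1 : h <= 1 by case/andP: hn => _ /le_trans; apply.
    have hlt1 : h < 1 by rewrite lt_neqAle h1.
    have an : a n < 1 by case/andP: hn => /le_lt_trans /(_ hlt1).
    have [_ _ /(_ an)[mE ME cE] _] := HB n.
    have [|C [x [C0 Hx Hol]]] := @cantor_holder _ (B n) h; first by rewrite mE ME.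
    have lev y : 0 <= y < 1 -> level_set mu h (x y).
      move=> y01; have [Kx ex] := Hx y y01.
      split; last exact: (local_dim_in_cvg cl cr Kx hle1 ex).
      have /andP[x0 x1] := cantor01 cl Kx.
      by rewrite in_itv/= x1 ltW.
    split; first by exists (x 0); apply: lev; rewrite lexx ltr01.
    rewrite -cE; apply: (hausdorff_dim_ge (C := C) (x := x)) => //.
    exact: cdim_ge0.
  by split; [have [n /low[]] := exn | move=> n /low[]].
have spec_in h : (fsupp `[0, 1] f `\ 1) h -> spectrum mu h = f h.
  move=> [suppf /eqP h1]; have /(family_fsupp Fam) exn := suppf.
  have [lev0 low] := supp1 h h1 exn.
  have [h01 fNy] := suppf.
  have h0 : 0 <= h by move: h01; rewrite /= in_itv => /andP[].
  have fh : f h = ereal_sup (range (fun n => fn n h%:E)) by exact: (F_sup Fam).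
  have f01 : (0 <= f h <= 1)%E.
    by have [fhN|//] := fv h h01; move: fNy; rewrite fhN ltxx.
  have fnlow n : (fn n h%:E <= spectrum mu h)%E.
    have [hn|hn] := pselect (a n <= h <= b n).
      by have [-> _ _] := family_in Fam hn; exact: low.
    by rewrite (family_out Fam h0 hn) leNye.
  apply/eqP; rewrite eq_le; apply/andP; split; last first.
    by rewrite fh; apply: ge_ereal_sup => _ [n _ <-].
  have [c [cE c0]] : exists c : R, f h = c%:E /\ 0 <= c.
    move: f01; case: (f h) => [c| |] /andP[c0 c1] //.
    by exists c; rewrite lee_fin in c0.
  rewrite cE; apply: hausdorff_dim_le => // s cs.
  apply: (@sub_hausdorff_measure_eq0 _ s _
    (\bigcup_n (if `[< a n <= h <= b n /\ a n < 1 >] then cantor (B n) else set0))).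
    move=> x /(lev_in h x h1)[n [hn an Kx]]; exists n => //.
    by rewrite asboolT.
  apply: hausdorff_measure_bigcup_eq0 => n; case: asboolP => [[hn an]|_].
    have [_ _ /(_ an)[_ _ cdE] _] := HB n.
    apply: hausdorff_cantor_eq0; rewrite cdE; apply: le_lt_trans cs.
    have [fnE _ _] := family_in Fam hn.
    by rewrite -lee_fin -fnE -cE fh; apply: ereal_sup_ubound; exists n.
  apply/hausdorff_measure_eq0P => d e d0 e0; exists (fun=> set0); split => //.
    by move=> _; apply: ge_ereal_sup => ? [? []].
  by rewrite eseries0 ?lee_fin ?ltW// => i _ _; exact: gauge_set0.
have spec_out h : ~ (fsupp `[0, 1] f `|` [set 1]) h -> spectrum mu h = -oo%E.
  move=> nh; have h1 : h != 1 by apply/eqP => hE; apply: nh; right.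
  rewrite /spectrum /hausdorff_dim ifT//; apply/eqP; rewrite -subset0 => x.
  move=> /(lev_in h x h1)[n [hn _ _]]; apply: nh; left.
  by apply/(family_fsupp Fam); exists n.
have mK : measurable (K : set (measurableTypeR R)).
  apply: bigcupT_measurable => n; apply: measurable_realfun.closed_measurable.
  exact: closed_cantor.
have K0 : lebesgue_measure (K : set (measurableTypeR R)) = 0%E.
  apply/eqP; rewrite eq_le measure_ge0 andbT.
  apply: (@le_trans _ _ (\sum_(n <oo) lebesgue_measure (cantor (B n)))%E).
    apply: measure_sigma_subadditive => // n.
    by apply: measurable_realfun.closed_measurable; exact: closed_cantor.
  by rewrite eseries0// => n _ _; exact: lebesgue_cantor_eq0.
have lev1 : lebesgue_measurable (level_set mu 1) /\
    completed_lebesgue_measure (level_set mu 1) = 1%E.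
  have m01 : measurable (`[0, 1]%classic : set (measurableTypeR R)).
    exact: measurable_itv.
  have l01 : lebesgue_measure (`[0, 1]%classic : set (measurableTypeR R)) = 1%E.
    by rewrite lebesgue_measure_itv/= lte_fin ltr01 oppr0 adde0.
  rewrite -l01; apply: (@lebesgue_measurable_squeeze _ (`[0, 1] `\` K)) => //.
  - exact: measurableD.
  - by move=> x [x01 nK]; split; last exact: lev_out.
  - by move=> x [].
  - by rewrite l01 ltry.
  - apply/eqP; rewrite eq_le measure_ge0 andbT -K0; apply: le_measure.
    + by rewrite inE; apply: measurableD => //; exact: measurableD.
    + by rewrite inE.
    + by move=> x [x01 nx]; apply: contrapT => nK; apply: nx.
exists mu; split => //.
- by rewrite (measure_supp_mixture_proba cl cr).
- by move=> h _; exact: spec_out.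
apply/seteqP; split => h.
  move=> [h0 sh]; apply: contrapT => /spec_out sE; move: sh; rewrite sE.
  by rewrite leeNy_eq.
have lev1n0 : level_set mu 1 !=set0.
  exists 0; split; first by rewrite in_itv/= lexx ler01.
  apply: lev_out => [|[n _ /(cantor01 cl)]]; rewrite ?lexx ?ler01//.
  by rewrite ltxx.
have s1 : (0 <= spectrum mu 1)%E by exact: hausdorff_dim_ge0.
move=> [suppf|->]; last by split.
  have h0 : 0 <= h by have [+ _] := suppf; rewrite /= in_itv => /andP[].
  split => //; have [->//|h1] := eqVneq h 1.
  have /(family_fsupp Fam) exn := suppf.
  by have [lev0 _] := supp1 h h1 exn; exact: hausdorff_dim_ge0.
Qed.
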